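(* Consider the Generalized Flow Time Problem on a single machine where all jobs have the same density $\delta=w_j/p_j$, and $g:[0,\infty)\to[0,\infty)$ is non-decreasing with $g(0)=0$. If $g$ is convex, then FIFO (always process the pending job with the earliest release time) is an optimal online algorithm for the fractional objective $\sum_j\delta\int_{r_j}^\infty g(t-r_j)x_j(t)\,dt$ and, for every $\epsilon>0$, a $(1+\epsilon)$-speed $\frac{1+\epsilon}{\epsilon}$-competitive algorithm for the integral objective $\sum_j w_j g(C_j-r_j)$. If $g$ is concave, the same holds for LIFO (always process the pending job with the latest release time).
   Context: Preemptive single machine; job $j$ has release time $r_j\ge0$, processing time $p_j>0$, weight $w_j>0$, revealed at $r_j$. A schedule of speed $s$ assigns rates $x_j(t)\ge0$, $x_j(t)=0$ for $t<r_j$, $\sum_j x_j(t)\le s$; $C_j$ is the first time with $\int_{r_j}^{C_j}x_j=p_j$. Optimal for the fractional objective means: on every instance, the fractional cost equals the minimum fractional cost over all unit-speed schedules. An online algorithm (speed 1) is $\alpha$-speed $\beta$-competitive if its cost is at most $\beta$ times the minimum cost over offline schedules of speed $1/\alpha$. *)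

(* Defs.v *)
From HB Require Import structures.
From mathcomp Require Import all_boot all_order all_algebra finmap.
From mathcomp Require Import all_classical all_reals all_analysis.

Set Implicit Arguments.
Unset Strict Implicit.
Unset Printing Implicit Defensive.

Import Order.TTheory GRing.Theory Num.Theory.
Import numFieldNormedType.Exports.

Local Open Scope fset_scope.
Local Open Scope classical_set_scope.
Local Open Scope ring_scope.

(* Jobs are labelled by arbitrary natural numbers; the labels carry no
   information about the jobs and only serve to compare two instances. *)
Record instance (R : realType) := Instance {
  jobs : {fset nat};
  release : nat -> R;
  proc : nat -> R;
  weight : nat -> R;
  release_ge0 : forall j, j \in jobs -> 0 <= release j;
  proc_gt0 : forall j, j \in jobs -> 0 < proc j;
  weight_gt0 : forall j, j \in jobs -> 0 < weight j }.

Definition equal_density (R : realType) (delta : R) (I : instance R) : Prop :=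
  forall j, j \in jobs I -> weight I j / proc I j = delta.

(* [x j t] is the rate given to job [j] at time [t]; only the values at
   [j \in jobs I] are meaningful. *)
Definition rates (R : realType) := nat -> R -> R.

Definition schedule (R : realType) (s : R) (I : instance R) (x : rates R) :
    Prop :=
  [/\ forall j, j \in jobs I -> measurable_fun [set: R] (x j),
      forall j t, j \in jobs I -> 0 <= x j t,
      forall j t, j \in jobs I -> t < release I j -> x j t = 0 &
      forall t, \sum_(j <- jobs I) x j t <= s].

Definition work (R : realType) (I : instance R) (x : rates R) (j : nat)
    (t : R) : \bar R :=
  (\int[lebesgue_measure]_(u in `[release I j, t]) (x j u)%:E)%E.

(* The times C with \int_(r_j)^C x_j = p_j. *)
Definition completion_times (R : realType) (I : instance R) (x : rates R)
    (j : nat) : set R :=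
  [set C | release I j <= C /\ work I x j C = (proc I j)%:E].

(* The work on a job is continuous in time, so the infimum is attained as soon
   as [completion_times] is nonempty: it is the first completion time. *)
Definition completion (R : realType) (I : instance R) (x : rates R)
    (j : nat) : R :=
  inf (completion_times I x j).

(* A schedule in which every C_j exists; these are the schedules over which
   costs are minimized. *)
Definition feasible (R : realType) (s : R) (I : instance R) (x : rates R) :
    Prop :=
  schedule s I x /\ forall j, j \in jobs I -> completion_times I x j !=set0.

Definition fractional_cost (R : realType) (g : R -> R) (delta : R)
    (I : instance R) (x : rates R) : \bar R :=
  (\sum_(j <- jobs I)
     delta%:E * \int[lebesgue_measure]_(t in `[release I j, +oo[)
                  (g (t - release I j) * x j t)%:E)%E.

Definition integral_cost (R : realType) (g : R -> R) (I : instance R)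
    (x : rates R) : R :=
  \sum_(j <- jobs I) weight I j * g (completion I x j - release I j).

Definition algorithm (R : realType) := instance R -> rates R.

Definition known_jobs (R : realType) (I : instance R) (t : R) : {fset nat} :=
  [fset j in jobs I | release I j <= t].

Definition same_until (R : realType) (t : R) (I I' : instance R) : Prop :=
  known_jobs I t = known_jobs I' t /\
  forall j, j \in known_jobs I t ->
    [/\ release I j = release I' j, proc I j = proc I' j &
        weight I j = weight I' j].

(* A unit-speed algorithm whose decisions up to time [t] depend only on the
   jobs released up to time [t]. *)
Definition online_algorithm (R : realType) (A : algorithm R) : Prop :=
  (forall I, schedule 1 I (A I)) /\
  forall I I' t, same_until t I I' ->
    forall j u, j \in known_jobs I t -> u <= t -> A I j u = A I' j u.

Definition pending (R : realType) (I : instance R) (x : rates R) (t : R)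
    (j : nat) : Prop :=
  [/\ j \in jobs I, release I j <= t & (work I x j t < (proc I j)%:E)%E].

Definition runs_only (R : realType) (I : instance R) (x : rates R) (t : R)
    (j : nat) : Prop :=
  forall k, k \in jobs I -> x k t = (k == j)%:R.

Definition idle (R : realType) (I : instance R) (x : rates R) (t : R) : Prop :=
  forall k, k \in jobs I -> x k t = 0.

(* Ties between equal release times may be broken in any way. *)
Definition fifo (R : realType) (A : algorithm R) : Prop :=
  forall (I : instance R) (t : R),
    ((forall j, ~ pending I (A I) t j) /\ idle I (A I) t) \/
    exists j, [/\ pending I (A I) t j,
      forall k, pending I (A I) t k -> release I j <= release I k &
      runs_only I (A I) t j].

Definition lifo (R : realType) (A : algorithm R) : Prop :=
  forall (I : instance R) (t : R),
    ((forall j, ~ pending I (A I) t j) /\ idle I (A I) t) \/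
    exists j, [/\ pending I (A I) t j,
      forall k, pending I (A I) t k -> release I k <= release I j &
      runs_only I (A I) t j].

Definition fractional_optimal (R : realType) (g : R -> R) (delta : R)
    (A : algorithm R) : Prop :=
  forall I, equal_density delta I ->
    feasible 1 I (A I) /\
    forall y, feasible 1 I y ->
      (fractional_cost g delta I (A I) <= fractional_cost g delta I y)%E.

(* [alpha]-speed [beta]-competitiveness for the integral objective on the
   instances of density [delta]: the algorithm has speed 1 and the offline
   optimum speed [1 / alpha]. *)
Definition integral_competitive (R : realType) (g : R -> R) (delta : R)
    (alpha beta : R) (A : algorithm R) : Prop :=
  forall I, equal_density delta I ->
    feasible 1 I (A I) /\
    ((integral_cost g I (A I))%:E <=
     beta%:E * ereal_inf [set (integral_cost g I y)%:E
                         | y in [set y | feasible (1 / alpha) I y]])%E.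

(* Main.v *)
(** Both policies give absolute priority to every class of jobs of the form
    [key r_j <= c] (key = id for FIFO, key = - for LIFO), and are work-conserving
    on it.  A busy-period argument shows that at every time such a class has
    received at least as much service as under any other unit-speed schedule.
    Convexity (resp. concavity) of [g] lets one write the cost [g (t - r_j)], up
    to a constant depending only on [r_j], as a sum of nonnegative nondecreasing
    functions of [t], one for each class containing [j]; a layer-cake formula
    then turns the domination of the classes into domination of the costs.
    For the integral objective the same busy-period argument shows that a
    schedule of speed [s] serves each class no earlier than the fictitious one
    in which job [j] gets [s p_j] at [r_j] and [(1 - s) p_j] at the time [C_j]
    when the policy completes it.  Hence [(1 - s) * sum w_j g (C_j - r_j)] is at
    most the fractional, and a fortiori the integral, cost of that schedule. *)

Require Import Defs.
From HB Require Import structures.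
From mathcomp Require Import all_boot all_order all_algebra finmap.
From mathcomp Require Import all_classical all_reals all_analysis.
From mathcomp Require Import measurable_realfun ring lra.

Set Implicit Arguments.
Unset Strict Implicit.
Unset Printing Implicit Defensive.

Import Order.TTheory GRing.Theory Num.Theory.
Import numFieldNormedType.Exports.

Local Open Scope classical_set_scope.
Local Open Scope ring_scope.

(** * Decomposition of the cost into class costs *)

Section Layers.
Variable R : realType.
Implicit Types (g h : R -> R) (key : R -> R).

Definition nonneg_nondecr (D : set R) h :=
  (forall t, D t -> 0 <= h t) /\
  (forall u t, D u -> D t -> u <= t -> h u <= h t).

(** Telescoping along the sorted list: for neighbours [a], [b] the increment [M + G a - G b] becomes
    a layer of the class of level [key a], on top of the layers that already make up [G b]. The
    constants [M] accumulate in [kappa]. *)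
Lemma layers (key : R -> R) (D : R -> set R) (G : R -> R -> R) :
  injective key ->
  (forall r u t, D r u -> u <= t -> D r t) ->
  (forall a b, key a <= key b -> D a `<=` D b) ->
  (forall r, nonneg_nondecr (D r) (G r)) ->
  (forall a b, key a <= key b -> exists2 M, 0 <= M &
     nonneg_nondecr (D a) (fun t => M + G a t - G b t)) ->
  forall s, sorted (fun a b => key a <= key b) s ->
  exists n (c : nat -> R) (h : nat -> R -> R) (kappa : R -> R),
  [/\ forall i, (i < n)%N -> c i \in map key s,
      forall i, nonneg_nondecr setT (h i),
      forall r, 0 <= kappa r &
      forall r t, r \in s -> D r t ->
        G r t + kappa r = \sum_(i < n | key r <= c i) h i t].
Proof.
move=> kinj Dup Dmono Gnn Hinc; elim=> [_|a s IH].
  exists 0%N, (fun=> 0), (fun _ _ => 0), (fun=> 0); split=> //.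
move=> sas; have ss : sorted (fun a b => key a <= key b) s by move: sas; apply: path_sorted.
have [n [c [h [kappa [cs hn k0 HG]]]]] := IH ss.
have [as_|ans] := boolP (a \in s).
  exists n, c, h, kappa; split=> //.
  - by move=> i /cs ci; rewrite /= inE ci orbT.
  - by move=> r t; rewrite inE => /orP[/eqP->|]; apply: HG.
have tr : transitive (fun a b => key a <= key b) by move=> x y z; apply: le_trans.
have amin r : r \in s -> key a <= key r.
  by move=> rs; have := order_path_min tr sas => /allP /(_ _ rs).
have [H [M [M0 [Hn Hd Hk]]]] : exists H M, 0 <= M /\ [/\ nonneg_nondecr setT H,
    forall i, (i < n)%N -> key a <= c i &
    forall t, D a t -> G a t + M = \sum_(i < n | key a <= c i) h i t + H t].
  (* Since [D a] is closed upwards and [f] is nonnegative there, extending [f] by 0 keeps it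
     nondecreasing. *)
  have patch f : nonneg_nondecr (D a) f ->
      nonneg_nondecr setT (fun t => if `[< D a t >] then f t else 0).
    move=> [f0 fm]; split=> [t _|u t _ _ ut]; first by case: ifPn => // /asboolP; apply: f0.
    case: ifPn => [/asboolP Du|_]; last by case: ifPn => // /asboolP; apply: f0.
    by rewrite (asboolT (Dup _ _ _ Du ut)); apply: fm => //; apply: Dup ut.
  have ca i : (i < n)%N -> key a <= c i.
    by move=> /cs /mapP[r rs ->]; apply: amin.
  case: s ss IH sas cs HG ans amin ca => [|b s] ss IH sas cs HG ans amin ca.
    exists (fun t => if `[< D a t >] then G a t else 0), 0; split=> //; split=> //; first exact/patch.
    move=> t Dt; rewrite (asboolT Dt) addr0; case: (n) cs => [|m] cs; first by rewrite big_ord0 add0r.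
    by have := cs 0%N isT.
  have kab : key a <= key b by apply: amin; rewrite inE eqxx.
  have [M M0 HM] := Hinc _ _ kab.
  exists (fun t => if `[< D a t >] then M + G a t - G b t else 0), (M + kappa b).
  split; first by rewrite addr_ge0.
  split=> //; first exact/patch.
  move=> t Dt; rewrite (asboolT Dt).
  (* Every earlier level is the key of an element of [b :: s], hence at least [key b]: both filters
     are always true. *)
  have -> : \sum_(i < n | key a <= c i) h i t = \sum_(i < n | key b <= c i) h i t.
    apply: eq_bigl => i; rewrite (ca i (ltn_ord i)).
    have /mapP[r rs ->] := cs i (ltn_ord i); symmetry.
    move: rs; rewrite inE => /orP[/eqP->|rs]; first by rewrite lexx.
    by move: ss => /= /(order_path_min tr) /allP /(_ _ rs).
  by rewrite -HG ?inE ?eqxx//; [lra | apply: Dmono Dt].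
exists n.+1, (fun i => if (i < n)%N then c i else key a),
  (fun i => if (i < n)%N then h i else H), (fun r => if r == a then M else kappa r).
split.
- move=> i _; case: ifPn => [/cs ci|_]; by rewrite /= inE ?eqxx// ci orbT.
- by move=> i; case: ifPn.
- by move=> r; case: ifPn.
move=> r t rs Dt; rewrite big_mkcond big_ord_recr /= ltnn.
under eq_bigr do rewrite ltn_ord.
rewrite -big_mkcond.
move: rs Dt; rewrite inE; have [-> _ Dt|ra /= rs Dt] := eqVneq r a.
  by rewrite lexx Hk.
(* Injectivity keeps every release time other than [a] out of the new class. *)
have -> : (key r <= key a) = false.
  apply/negP => kra; move/eqP: ra; apply; apply: kinj; apply/eqP.
  by rewrite eq_le kra amin.
by rewrite addr0 HG.
Qed.

(** [g] is constrained on nonnegative arguments only; extended by 0 it is monotone on the whole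
    line, because it is nonnegative. *)
Definition extend0 g (t : R) := if 0 <= t then g t else 0.

Lemma extend0_nonneg_nondecr g :
  (forall t, 0 <= t -> 0 <= g t) ->
  (forall s t, 0 <= s -> s <= t -> g s <= g t) ->
  nonneg_nondecr setT (extend0 g).
Proof.
move=> gp gm; rewrite /extend0; split=> [t _|u t _ _ ut]; first by case: ifPn => // /gp.
case: ifPn => [u0|_]; last by case: ifPn => // /gp.
by rewrite (le_trans u0 ut) gm.
Qed.

(** In the sum of the two convexity inequalities the weights [l] and [1 - l] cancel. Applied to [g]
    for FIFO and to [- g] for LIFO. *)
Lemma convex_increments g :
  convex_function (`[0, +oo[%classic : set R^o) g ->
  forall u t e : R, 0 <= u -> u <= t -> 0 <= e ->
  g (u + e) - g u <= g (t + e) - g t.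
Proof.
move=> gc u t e u0 ut e0.
have [te0|te0] := eqVneq (t + e - u) 0.
  have -> : t = u by lra.
  by have -> : e = 0 by lra.
have tep : 0 < t + e - u by rewrite lt_neqAle eq_sym te0; lra.
pose l := (t - u) / (t + e - u).
have l0 : 0 <= l by rewrite divr_ge0; lra.
have l1 : l <= 1 by rewrite ler_pdivrMr//; lra.
have in0 (v : R) : 0 <= v -> v \in (`[0, +oo[%classic : set R).
  by move=> v0; rewrite inE /= in_itv /= v0.
have lE : l * (t + e - u) = t - u by rewrite /l divfK.
have t0 : 0 <= t + e by lra.
have c1 : g (l * u + (1 - l) * (t + e)) <= l * g u + (1 - l) * g (t + e) :=
  gc (Itv01 l0 l1) u (t + e) (in0 _ u0) (in0 _ t0).
have c2 : g (l * (t + e) + (1 - l) * u) <= l * g (t + e) + (1 - l) * g u :=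
  gc (Itv01 l0 l1) (t + e) u (in0 _ t0) (in0 _ u0).
(* [u + e] and [t] are the two mirror convex combinations of [u] and [t + e] *)
have e1 : l * u + (1 - l) * (t + e) = u + e by lra.
have e2 : l * (t + e) + (1 - l) * u = t by lra.
move: c1 c2; rewrite e1 e2; lra.
Qed.
End Layers.

Section Layered.
Variable R : realType.
Variables (g : R -> R).
Hypothesis g_ge0 : forall t : R, 0 <= t -> 0 <= g t.
Hypothesis g_nondecr : forall s t : R, 0 <= s -> s <= t -> g s <= g t.
Hypothesis g0 : g 0 = 0.

(* Job [r] belongs to the classes [c i >= key r]; the offset [kappa r] is paid by
   every schedule alike. *)
Definition layered (key : R -> R) := forall s : seq R,
  exists n (c : nat -> R) (h : nat -> R -> R) (kappa : R -> R),
  [/\ forall i, nonneg_nondecr setT (h i),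
      forall r, 0 <= kappa r &
      forall r t, r \in s -> r <= t ->
        g (t - r) + kappa r = \sum_(i < n | key r <= c i) h i t].

Let G (r t : R) := extend0 g (t - r).

Lemma layered_from (key : R -> R) (D : R -> set R) :
  injective key ->
  (forall r t, r <= t -> D r t) ->
  (forall r u t, D r u -> u <= t -> D r t) ->
  (forall a b, key a <= key b -> D a `<=` D b) ->
  (forall a b, key a <= key b -> exists2 M, 0 <= M &
     nonneg_nondecr (D a) (fun t => M + G a t - G b t)) ->
  layered key.
Proof.
move=> kinj Drt Dup Dmono Hinc s.
have ttl : total (fun a b => key a <= key b) by move=> a b; apply: le_total.
have [] := @layers _ key D G kinj Dup Dmono _ Hinc _ (sort_sorted ttl s).
  move=> r; have [e0 em] := extend0_nonneg_nondecr g_ge0 g_nondecr.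
  by split=> [t _|u t _ _ ut]; rewrite /G ?e0//; apply: em => //; lra.
move=> n [c [h [kappa [_ hn k0 HG]]]]; exists n, c, h, kappa; split=> // r t rs rt.
rewrite -HG ?mem_sort//; last exact: Drt.
by rewrite /G /extend0 subr_ge0 rt.
Qed.

(** For [a <= b] the job released at [a] is the older one, and convexity makes its lead
    [g (t - a) - g (t - b)] nondecreasing in [t]. The lead is nonnegative by monotonicity of [g], so
    [M = 0] works on the whole line. *)
Lemma layered_convex : convex_function (`[0, +oo[%classic : set R^o) g ->
  layered idfun.
Proof.
move=> gc; apply: (@layered_from _ (fun=> setT)) => // a b /= ab.
exists 0 => //; have [e0 em] := extend0_nonneg_nondecr g_ge0 g_nondecr.
split=> [t _|u t _ _ ut]; rewrite /G.
  by rewrite add0r subr_ge0; apply: em => //; lra.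
rewrite !add0r; have [ub|ub] := leP 0 (u - b).
  have := convex_increments gc ub (_ : u - b <= t - b) (_ : 0 <= b - a).
  rewrite !addrA !subrK /extend0 ub.
  have -> : 0 <= t - b by lra.
  have -> : 0 <= u - a by lra.
  have -> : 0 <= t - a by lra.
  by apply; lra.
have -> : extend0 g (u - b) = 0 by rewrite /extend0 leNgt ub.
rewrite subr0 lerBrDr.
have [ua|ua] := ltP (u - a) 0.
  have -> : extend0 g (u - a) = 0 by rewrite /extend0 leNgt ua.
  by rewrite add0r; apply: em => //; lra.
have [tb|tb] := ltP (t - b) 0.
  have -> : extend0 g (t - b) = 0 by rewrite /extend0 leNgt tb.
  by rewrite addr0; apply: em => //; lra.
(* Superadditivity of [g], from convexity and [g 0 = 0]. As [u < b], the ages [t - b] and [u - a]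
   add up to at most [t - a]. *)
have := convex_increments gc (lexx 0) tb ua; rewrite add0r g0 subr0.
have := g_nondecr (_ : 0 <= t - b + (u - a)) (_ : _ <= t - a).
rewrite /extend0 ua tb; have -> : 0 <= t - a by lra.
by move=> /(_ _ _); lra.
Qed.

(** For [b <= a] concavity makes [g (t - a) - g (t - b)] nondecreasing from [t = a] on, where it
    starts at [- g (a - b)]; hence [M = g (a - b)]. Before [a] the difference of the extended costs
    is nonincreasing instead, which is why the domain is [[a, +oo[]. *)
Lemma layered_concave :
  convex_function (`[0, +oo[%classic : set R^o) (fun t => - g t) ->
  layered -%R.
Proof.
move=> gc; apply: (@layered_from _ (fun a => `[a, +oo[%classic)) => //.
- by move=> r t rt; rewrite /= in_itv /= rt.
- by move=> r u t; rewrite /= !in_itv /= !andbT; apply: le_trans.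
- by move=> a b ab t; rewrite /= !in_itv /= !andbT; apply: le_trans; lra.
move=> a b; rewrite lerN2 => ba; exists (g (a - b)); first by rewrite g_ge0// subr_ge0.
have inc u t : a <= u -> u <= t ->
    g (a - b) + G a u - G b u <= g (a - b) + G a t - G b t.
  move=> au ut; have := convex_increments gc (_ : 0 <= u - a) (_ : u - a <= t - a) (_ : 0 <= a - b).
  rewrite !addrA !subrK /G /extend0.
  have -> : 0 <= u - a by lra.
  have -> : 0 <= t - a by lra.
  have -> : 0 <= u - b by lra.
  have -> : 0 <= t - b by lra.
  by move=> H; have := H _ _ _; lra.
split=> [t|u t]; rewrite /= !in_itv /= !andbT.
  move=> at_; have := inc _ _ (lexx a) at_; apply: le_trans.
  rewrite /G subrr /extend0 lexx g0; have -> : 0 <= a - b by lra.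
  by rewrite addr0 subrr.
by move=> au _; apply: inc.
Qed.
End Layered.

(** * Layer-cake formula and bounded rates *)

Section LayerCake.
Variable R : realType.
Local Notation mu := (@lebesgue_measure R).

(** The inner integral of the layer-cake formula. With [a] a mass and [b] a height it also evaluates
    the atoms of the fictitious schedule. *)
Lemma layer_cake_point (a b : R) : 0 <= a -> 0 <= b ->
  measurable_fun (`[0, +oo[%classic : set R) (fun v : R => (a * (v < b)%R%:R)%:E) /\
  (\int[mu]_(v in `[0%R, +oo[) (a * (v < b)%R%:R)%:E = (a * b)%:E)%E.
Proof.
move=> a0 b0.
have E (v : R) : (v < b)%R%:R = \1_`]-oo, b[%classic v :> R.
  by rewrite indicE; congr (nat_of_bool _)%:R; apply/idP/idP; rewrite inE /= in_itv.
split.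
  apply/measurable_EFinP; apply: measurable_funM => //.
  rewrite (_ : (fun v : R => _) = \1_`]-oo, b[%classic); first exact: measurable_indic.
  by apply/funext => v; rewrite -E.
transitivity (\int[mu]_(v in `[0%R, +oo[) (a%:E * (\1_`]-oo, b[%classic v)%:E))%E.
  by apply: eq_integral => v _; rewrite E EFinM.
rewrite ge0_integralZl//; last exact/measurable_EFinP/measurable_indic.
rewrite integral_indic//= setIC -(set_itv_splitI `[0%R, b[) lebesgue_measure_itv/= lte_fin.
by case: ltgtP b0 => // [_ _|<- _]; rewrite ?EFinN ?sube0 ?mulr0 ?mule0.
Qed.

(** Tonelli on the region under the graph of [h], with density [f] in [t]: integrating over [v]
    first gives the left-hand side, over [t] first the right-hand side. *)
Lemma layer_cake (D : set R) (f h : R -> R) :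
  measurable D -> measurable_fun setT f -> (forall t, D t -> 0 <= f t) ->
  nonneg_nondecr setT h ->
  measurable_fun (`[0, +oo[%classic : set R)
    (fun v : R => (\int[mu]_(t in D `&` [set t | (v < h t)%R]) (f t)%:E)%E) /\
  (\int[mu]_(t in D) (h t * f t)%:E =
   \int[mu]_(v in `[0%R, +oo[) \int[mu]_(t in D `&` [set t | (v < h t)%R]) (f t)%:E)%E.
Proof.
move=> mD mf f0 [h0 hm].
pose T := measurableTypeR R.
have fD0 t : 0 <= (f \_ D) t.
  by rewrite patchE; case: ifPn => //; rewrite inE => /f0.
have mfD : measurable_fun setT (f \_ D).
  by apply/(measurable_restrictT _ mD); apply: measurable_funTS.
have mh : measurable_fun setT h by apply: nondecreasing_measurable => // u t; apply: hm.
(* [F] carries the restrictions to [D] and to [0 <= v], so that both iterated integrals run over the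
   whole line. *)
pose F (p : T * T) := ((f \_ D) p.1 * ((0 <= p.2) && (p.2 < h p.1))%R%:R)%:E.
have mF : measurable_fun setT F.
  apply/measurable_EFinP; apply: measurable_funM.
    by apply: (measurableT_comp mfD); exact: measurable_fst.
  pose A : set (T * T) := [set p | (0 <= p.2) && (p.2 < h p.1)].
  have mA : measurable A.
    pose f1 (p : T * T) := (0 <= p.2)%R.
    pose f2 (p : T * T) := (p.2 < h p.1)%R.
    rewrite (_ : A = f1 @^-1` [set true] `&` f2 @^-1` [set true]); last first.
      by apply/seteqP; split => p /= /andP.
    apply: measurableI.
    - have : measurable_fun setT f1 by exact: measurable_fun_ler.
      by move=> /(_ measurableT [set true]); rewrite setTI; exact.
    - have : measurable_fun setT f2.
        by apply: measurable_fun_ltr => //; apply: (measurableT_comp mh); exact: measurable_fst.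
      by move=> /(_ measurableT [set true]); rewrite setTI; exact.
  rewrite (_ : (fun p => _) = \1_A); first exact: measurable_indic.
  by apply/funext => p; rewrite indicE; congr (nat_of_bool _)%:R; apply/idP/idP; rewrite inE.
have F0 p : (0 <= F p)%E by rewrite lee_fin mulr_ge0.
have FG v : 0 <= v -> (\int[mu]_(t in D `&` [set t | (v < h t)%R]) (f t)%:E = \int[mu]_t F (t, v))%E.
  move=> v0; rewrite integral_mkcond; apply: eq_integral => t _.
  rewrite !patchE /F /= v0 /= patchE in_setI.
  case: (t \in D); last by rewrite mul0r.
  have -> : (t \in [set t0 | v < h t0]) = (v < h t) by apply/idP/idP; rewrite inE.
  by case: (v < h t); rewrite ?mulr1 ?mulr0.
have mG : measurable_fun setT (fun v => (\int[mu]_t F (t, v))%E).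
  exact: (measurable_fun_fubini_tonelli_G (m1 := mu) F mF F0).
split.
  apply: (eq_measurable_fun (fun v => (\int[mu]_t F (t, v))%E)); last exact: measurable_funTS.
  by move=> v; rewrite inE /= in_itv /= andbT => v0; rewrite FG.
transitivity (\int[mu]_t \int[mu]_v F (t, v))%E.
  rewrite integral_mkcond; apply: eq_integral => t _.
  have -> : ((fun t => (h t * f t)%:E) \_ D) t = ((f \_ D) t * h t)%:E.
    by rewrite !patchE; case: ifP; rewrite ?mul0r// mulrC.
  have [_ <-] := layer_cake_point (fD0 t) (h0 t I).
  rewrite integral_mkcond; apply: eq_integral => v _.
  rewrite patchE /F /=.
  have -> : (v \in `[0, +oo[%classic) = (0 <= v).
    by apply/idP/idP; rewrite inE /= in_itv /= andbT.
  by case: (0 <= v); rewrite ?mulr0.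
rewrite (fubini_tonelli (m1 := mu) (m2 := mu) F mF F0).
rewrite [RHS]integral_mkcond; apply: eq_integral => v _.
rewrite patchE.
have -> : (v \in `[0, +oo[%classic) = (0 <= v).
  by apply/idP/idP; rewrite inE /= in_itv /= andbT.
have [v0|v0] := leP 0 v; first by rewrite FG.
by apply: integral0_eq => t _; rewrite /F /= leNgt v0 mulr0.
Qed.

End LayerCake.

Section BoundedRate.
Variable R : realType.
Local Notation mu := (@lebesgue_measure R).
Variables (f : R -> R) (M : R).
Hypothesis mf : measurable_fun setT f.
Hypothesis f0 : forall t, 0 <= f t.
Hypothesis fM : forall t, f t <= M.

Local Notation W D := (\int[mu]_(t in D) (f t)%:E)%E.

Let mfE (D : set R) : measurable_fun D (EFin \o f).
Proof. by apply/measurable_EFinP; apply: measurable_funTS. Qed.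

Lemma integral_rate_ge0 (D : set R) : (0 <= W D)%E.
Proof. by apply: integral_ge0 => t _; rewrite lee_fin. Qed.

Lemma integral_rate_mono (A B : set R) : measurable A -> measurable B ->
  A `<=` B -> (W A <= W B)%E.
Proof.
move=> mA mB AB; apply: (@ge0_subset_integral _ _ _ mu A B mA mB _ _ _ AB).
  exact: mfE.
by move=> t _; rewrite lee_fin.
Qed.

Lemma integral_rate_le (D : set R) : measurable D -> (W D <= M%:E * mu D)%E.
Proof.
move=> mD; rewrite -integral_cst//; apply: ge0_le_integral => //.
- by move=> t _; rewrite lee_fin.
- exact: mfE.
- by move=> t _; rewrite /cst lee_fin.
Qed.

Lemma integral_rate_split (A B : set R) : measurable A -> measurable B ->
  (W A = W (A `&` B) + W (A `\` B))%E.
Proof.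
move=> mA mB; rewrite -(@ge0_integral_setU _ _ _ mu (A `&` B) (A `\` B)); first by rewrite setUIDK.
- exact: measurableI.
- exact: measurableD.
- exact: mfE.
- by move=> t _; rewrite lee_fin.
- by apply/disj_setPS => t [[_ Bt] [_]]; apply.
Qed.

Lemma integral_rate_itv_fin (a b : R) : W `[a, b] \is a fin_num.
Proof.
rewrite ge0_fin_numE ?integral_rate_ge0//.
apply: (le_lt_trans (integral_rate_le _)) => //.
by rewrite lebesgue_measure_itv /=; case: ifP; rewrite ?mule0// -EFinB -EFinM ltry.
Qed.

(** Intermediate value theorem: cumulative work is continuous, being the integral of an integrable
    rate. *)
Lemma reach (r t p : R) : 0 <= p -> r <= t -> (p%:E <= W `[r, t])%E ->
  exists2 c, r <= c <= t & W `[r, c] = p%:E.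
Proof.
move=> p0 rt pW.
have intf : mu.-integrable `[r, t] (EFin \o f).
  apply/integrableP; split; first exact: mfE.
  have -> : (\int[mu]_(x in `[r, t]) `|(EFin \o f) x| = W `[r, t])%E.
    by apply: eq_integral => x _; rewrite /= ger0_norm.
  by rewrite -ge0_fin_numE ?integral_rate_itv_fin// integral_rate_ge0.
have cont := parameterized_integral_continuous rt intf.
have [] := IVT rt cont (v := p).
  apply/andP; split.
    rewrite ge_min; apply/orP; left.
    by rewrite /parameterized_integral set_itv1 Rintegral_set1.
  rewrite le_max; apply/orP; right.
  by rewrite -lee_fin /parameterized_integral /Rintegral fineK// integral_rate_itv_fin.
move=> c; rewrite in_itv /= => crt cp; exists c => //.
by rewrite -cp /parameterized_integral /Rintegral fineK// integral_rate_itv_fin.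
Qed.

(** By monotonicity the work at the infimum is at most [p]. As the rate is at most [M], a deficit
    [p - w] there takes a delay bounded below to make up, whereas members of [T] lie arbitrarily
    close to the infimum. *)
Lemma inf_reach (r p : R) :
  let T := [set c | r <= c /\ W `[r, c] = p%:E] in
  T !=set0 -> T (inf T).
Proof.
move=> T T0.
have hinf : has_inf T by split=> //; exists r => c [].
have rc0 : r <= inf T by apply: lb_le_inf => // c [].
split=> //; set c0 := inf T in rc0 *.
have fin := integral_rate_itv_fin r c0.
apply/eqP; rewrite eq_le; apply/andP; split.
  have [c Tc] := T0; have [_ <-] := Tc.
  apply: integral_rate_mono => //; apply: subset_itvl; rewrite bnd_simp.
  by apply: ge_inf => //; case: hinf.
rewrite leNgt; apply/negP => lt.
have M0 : 0 <= M by apply: le_trans (f0 0) (fM 0).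
pose w := fine (W `[r, c0]).
have wE : W `[r, c0] = w%:E by rewrite fineK.
move: lt; rewrite wE lte_fin => lt.
(* The [+ 1] keeps the denominator positive when [M = 0]. *)
have e0 : 0 < (p - w) / (M + 1) by rewrite divr_gt0; lra.
have [c Tc cc0] := inf_adherent e0 hinf.
have [rc Wc] := Tc.
have c0c : c0 <= c by apply: ge_inf => //; case: hinf.
have : (p%:E <= w%:E + (M * (c - c0))%:E)%E.
  rewrite -Wc -wE (@integral_rate_split _ `[r, c0])//.
  apply: leeD; first by apply: integral_rate_mono => //; exact: measurableI.
  apply: (le_trans (integral_rate_le _)); first exact: measurableD.
  rewrite EFinM; apply: lee_wpmul2l; first by rewrite lee_fin.
  apply: (@le_trans _ _ (mu `]c0, c])).
    apply: le_measure; rewrite ?inE//; first exact: measurableD.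
    move=> t [] /=; rewrite !in_itv /= => /andP[rt ->] /negP.
    by rewrite rt /= -ltNge => ->.
  by rewrite lebesgue_measure_itv /= lte_fin; case: ifP; rewrite ?EFinB// => _; rewrite lee_fin subr_ge0.
rewrite -EFinD lee_fin => H.
have : c - c0 < (p - w) / (M + 1) by move: cc0; rewrite -/c0; lra.
rewrite ltr_pdivlMr; last by lra.
have : 0 <= c - c0 by lra.
nra.
Qed.

End BoundedRate.

(** * Busy periods and domination of the classes *)

(** Schedules are constrained only at the jobs of the instance, so measurability and sign are
    assumed for [n \in s] alone; elsewhere [f] is replaced by 0 before sum and integral are
    exchanged. *)
Lemma ge0_integral_sum_seq d (T : measurableType d) (R : realType)
    (mu : {measure set T -> \bar R}) (D : set T) (s : seq nat) (P : pred nat)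
    (f : nat -> T -> \bar R) :
  measurable D -> (forall n, n \in s -> measurable_fun D (f n)) ->
  (forall n t, n \in s -> D t -> (0 <= f n t)%E) ->
  (\int[mu]_(t in D) (\sum_(n <- s | P n) f n t) =
   \sum_(n <- s | P n) \int[mu]_(t in D) f n t)%E.
Proof.
move=> mD mf f0.
pose f' n t := if (n \in s) then f n t else 0%E.
transitivity (\int[mu]_(t in D) (\sum_(n <- [seq n <- s | P n]) f' n t))%E.
  apply: eq_integral => t _; rewrite big_filter [LHS]big_seq_cond [RHS]big_seq_cond.
  by apply: eq_bigr => n /andP[ns _]; rewrite /f' ns.
rewrite ge0_integral_sum//.
- rewrite big_filter [LHS]big_seq_cond [RHS]big_seq_cond.
  apply: eq_bigr => n /andP[ns _]; apply: eq_integral => t _.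
  by rewrite /f' ns.
- by move=> n; rewrite /f'; case: (boolP (n \in s)) => [/mf|_].
- by move=> n t Dt; rewrite /f'; case: ifPn => // ns; apply: f0.
Qed.

Section Schedules.
Variable R : realType.
Local Notation mu := (@lebesgue_measure R).
Implicit Types (I : instance R) (x y : rates R) (C : nat -> R) (key : R -> R).

Lemma rate_le s I y j t : schedule s I y -> j \in jobs I -> y j t <= s.
Proof.
move=> [_ y0 _ ys] jI; apply: le_trans (ys t).
rewrite (bigD1_seq j)//= lerDl big_seq_cond.
by apply: sumr_ge0 => i /andP[iI _]; apply: y0.
Qed.

Lemma sum_rate_le s I y (P : pred nat) t : schedule s I y ->
  \sum_(j <- jobs I | P j) y j t <= s.
Proof.
move=> [_ y0 _ ys]; apply: le_trans (ys t).
rewrite [leRHS](bigID P)/= lerDl big_seq_cond.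
by apply: sumr_ge0 => i /andP[iI _]; apply: y0.
Qed.

Lemma work_mono s I y j : schedule s I y -> j \in jobs I ->
  forall a b, a <= b -> (work I y j a <= work I y j b)%E.
Proof.
move=> sy jI a b ab; have [my y0 _ _] := sy.
apply: (integral_rate_mono (my _ jI) (y0 _ ^~ jI)) => //.
by apply: subset_itvl; rewrite bnd_simp.
Qed.

Definition completes I y C :=
  forall j, j \in jobs I -> completion_times I y j (C j).

(** Work after [C j] is discarded: a schedule may keep serving a completed job, and the cut makes
    the total service exactly [proc I j]. *)
Definition served I y C j (D : set R) : R :=
  fine (\int[mu]_(t in `[release I j, C j] `&` D) (y j t)%:E).

Section Served.
Variables (s : R) (I : instance R) (y : rates R) (C : nat -> R).
Hypothesis sy : schedule s I y.
Hypothesis cy : completes I y C.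
Variables (j : nat) (jI : j \in jobs I).

Let my : measurable_fun setT (y j). Proof. by case: sy => my _ _ _; apply: my. Qed.
Let y0 t : 0 <= y j t. Proof. by case: sy => _ y0 _ _; apply: y0. Qed.
Let ys t : y j t <= s. Proof. exact: rate_le sy jI. Qed.

Lemma servedE D : measurable D ->
  (served I y C j D)%:E = (\int[mu]_(t in `[release I j, C j] `&` D) (y j t)%:E)%E.
Proof.
move=> mD; rewrite fineK// ge0_fin_numE ?(integral_rate_ge0 y0)//.
apply: (@le_lt_trans _ _ (\int[mu]_(t in `[release I j, C j]) (y j t)%:E)%E).
  by apply: (integral_rate_mono my y0) => //; apply: measurableI.
rewrite -ge0_fin_numE; first exact: (integral_rate_itv_fin my y0 ys).
exact: (integral_rate_ge0 y0).
Qed.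

Lemma served_ge0 D : 0 <= served I y C j D.
Proof. by rewrite fine_ge0// (integral_rate_ge0 y0). Qed.

Lemma served_mono A B : measurable A -> measurable B ->
  `[release I j, C j] `&` A `<=` B -> served I y C j A <= served I y C j B.
Proof.
move=> mA mB AB; rewrite -lee_fin !servedE//.
apply: (integral_rate_mono my y0); [exact: measurableI|exact: measurableI|].
by move=> t At; split; [case: At|apply: AB].
Qed.

Lemma served_full D : measurable D ->
  `[release I j, C j] `<=` D -> served I y C j D = proc I j.
Proof.
move=> mD CD; apply/EFin_inj; rewrite servedE// setIidl//.
by have [_] := cy jI.
Qed.

Lemma served_le D : measurable D -> served I y C j D <= proc I j.
Proof.
by move=> mD; rewrite -(@served_full setT)//; apply: served_mono.
Qed.

Lemma served_setC D : measurable D ->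
  served I y C j (~` D) = proc I j - served I y C j D.
Proof.
move=> mD; apply/eqP; rewrite eq_sym subr_eq; apply/eqP/EFin_inj.
rewrite EFinD !servedE//; last exact: measurableC.
have [_ <-] := cy jI.
rewrite /work (@integral_rate_split _ _ my y0 `[release I j, C j] D)// addeC.
by rewrite setDE.
Qed.

End Served.

(** Jobs released from [t0] on are served only from [t0] on, and share a total rate of at most
    [s]. *)
Lemma served_after_le s I y C (P : pred nat) (L : set R) (t0 : R) :
  schedule s I y -> measurable L ->
  ((\sum_(j <- jobs I | P j && (t0 <= release I j)) served I y C j L)%:E <=
   s%:E * mu (L `&` `]t0, +oo[))%E.
Proof.
move=> sy mL; have [my y0 _ ys] := sy.
have mD : measurable (L `&` `]t0, +oo[) by apply: measurableI.
rewrite -integral_cst//= -sumEFin.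
apply: (@le_trans _ _ (\int[mu]_(t in L `&` `]t0, +oo[)
   \sum_(j <- jobs I | P j && (t0 <= release I j)%R) (y j t)%:E)%E); last first.
  apply: ge0_le_integral => //.
  - move=> t _; rewrite big_seq_cond; apply: sume_ge0 => j /andP[jI _].
    by rewrite lee_fin y0.
  (* Nothing is known of [y j] outside [jobs I]; the guard makes every summand measurable. *)
  - apply: (eq_measurable_fun (fun t : R => (\sum_(j <- [seq j <- jobs I | P j && (t0 <= release I j)%R])
      (if (j \in jobs I) then y j t else 0)%:E)%E)).
      move=> t _; rewrite big_filter [LHS]big_seq_cond [RHS]big_seq_cond.
      by apply: eq_bigr => n /andP[-> _].
    apply: emeasurable_sum => j; apply/measurable_EFinP.
    by case: (boolP (j \in jobs I)) => // jI; apply: measurable_funTS; apply: my.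
  - by move=> t _; rewrite sumEFin lee_fin (sum_rate_le _ _ sy).
rewrite ge0_integral_sum_seq//; last 2 first.
- by move=> j jI; apply/measurable_EFinP; apply: measurable_funTS; apply: my.
- by move=> j t jI _; rewrite lee_fin y0.
rewrite big_seq_cond [leRHS]big_seq_cond; apply: lee_sum => j /and3P[jI _ t0j].
(* A job released at [t0] may be served at [t0] itself: a null set. *)
rewrite (servedE C sy jI)// -(@integral_setD1 _ _ t0)//; last 2 first.
- by apply: measurableD => //; apply: measurableI.
- by apply/measurable_EFinP; apply: measurable_funTS; apply: my.
apply: (integral_rate_mono (my _ jI) (y0 _ ^~ jI)) => //.
  by apply: measurableD => //; apply: measurableI.
move=> t [[/=]]; rewrite !in_itv /= andbT => /andP[rt _] Lt /eqP tt0; split=> //.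
by rewrite lt_neqAle eq_sym tt0 (le_trans t0j rt).
Qed.

(** Upper half of the busy-period argument, valid for any schedule: jobs released before [t0] count
    at most in full, and the others share [l] units of time at rate [s]. *)
Lemma served_sum_le s I y C (P : pred nat) (L : set R) (t0 l : R) :
  schedule s I y -> completes I y C -> measurable L ->
  mu (L `&` `]t0, +oo[) = l%:E ->
  \sum_(j <- jobs I | P j) served I y C j L <=
  \sum_(j <- jobs I | P j && (release I j < t0)) proc I j + s * l.
Proof.
move=> sy cy mL El.
rewrite (bigID (fun j => release I j < t0))/=; apply: lerD.
  rewrite big_seq_cond [leRHS]big_seq_cond; apply: ler_sum => j /andP[jI _].
  exact: (served_le sy cy jI).
under eq_bigl do rewrite -leNgt.
by rewrite -lee_fin EFinM -El; apply: served_after_le.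
Qed.

(** Common form of [fifo] ([key = idfun]) and [lifo] ([key = -%R]). *)
Definition prioritizes key I x := forall t,
  ((forall j, ~ pending I x t j) /\ idle I x t) \/
  exists j, [/\ pending I x t j,
    forall k, pending I x t k -> key (release I j) <= key (release I k) &
    runs_only I x t j].

(** Downsets of times arise as the sublevel sets of the layers. *)
Definition downset (L : set R) := forall t u, L t -> u <= t -> L u.

Lemma measurable_downset (L : set R) : downset L -> measurable L.
Proof.
move=> dL; apply: is_interval_measurable => a b La Lb t /andP[_ tb].
exact: dL tb.
Qed.

(* [t0] is the last time in [L] at which the class of the jobs of key at most
   [c] is exhausted; from then on the class is served at full rate. *)
Lemma busy_period key I x C c (L : set R) :
  schedule 1 I x -> prioritizes key I x -> completes I x C ->
  (forall j t, j \in jobs I -> release I j <= t ->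
     ((proc I j)%:E <= work I x j t)%E -> C j <= t) ->
  downset L -> L != setT ->
  exists t0 l, [/\ mu (L `&` `]t0, +oo[) = l%:E,
    forall j, j \in jobs I -> key (release I j) <= c -> release I j < t0 ->
      L (C j) &
    l <= \sum_(j <- jobs I | (key (release I j) <= c) && (t0 <= release I j))
           served I x C j L].
Proof.
move=> sx px cx Cfirst dL /eqP LT.
have mL := measurable_downset dL.
have [mx x0 xr xs] := sx.
have [L0|/set0P[a La]] := eqVneq L set0.
  (* No job is released before time 0, so [t0 = 0] leaves nothing to prove about early jobs. *)
  exists 0, 0; split.
  - by rewrite L0 set0I measure0.
  - by move=> j jI _; rewrite ltNge release_ge0.
  - by rewrite big_seq_cond; apply: sumr_ge0 => j /andP[jI _]; apply: (served_ge0 _ sx).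
have [u Lu] : exists u, ~ L u.
  by apply: contrapT => H; apply: LT; apply/seteqP; split=> // t _; apply: contrapT => Lt; apply: H; exists t.
have Lltu t : L t -> t < u.
  by move=> Lt; rewrite ltNge; apply/negP => ut; apply: Lu; apply: dL ut.
(* The strict [release I j < t] lets the starting time of a busy period belong to [S], although jobs
   released at that time are pending. *)
pose S := [set t | L t /\ forall j, j \in jobs I -> key (release I j) <= c ->
  release I j < t -> ~ pending I x t j].
have S0 : S (Num.min a 0).
  split; first by apply: dL La _; rewrite ge_min lexx.
  by move=> j jI _; rewrite lt_min (ltNge _ 0) release_ge0// andbF.
have hS : has_sup S.
  by split; [exists (Num.min a 0)|exists u => t [/Lltu/ltW]].
set t0 := sup S.
have Pdone t j : j \in jobs I -> release I j <= t -> ~ pending I x t j -> C j <= t.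
  move=> jI rt np; apply: Cfirst => //; rewrite leNgt; apply/negP => lt.
  by apply: np; split.
have Ppend t j : pending I x t j -> t <= C j.
  move=> [jI rt wt]; rewrite leNgt; apply/negP => Ct.
  have [_ wC] := cx _ jI.
  have := work_mono sx jI (ltW Ct); rewrite wC leNgt; by rewrite wt.
have early j : j \in jobs I -> key (release I j) <= c -> release I j < t0 ->
    L (C j) /\ C j <= t0.
  move=> jI kj rj.
  have d0 : 0 < t0 - release I j by rewrite subr_gt0.
  (* The supremum may lie outside [S], and even outside [L]; a member [v] of [S] later than the
     release of [j] suffices. *)
  have [v Sv] := sup_adherent d0 hS; rewrite -/t0 subKr => rv; have [Lv pv] := Sv.
  have Cv : C j <= v by apply: Pdone => //; [exact: ltW|apply: pv].
  split; first exact: dL Cv.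
  by apply: le_trans Cv _; apply: sup_upper_bound.
pose D := L `&` `]t0, +oo[.
have mD : measurable D by apply: measurableI.
have Dfin : mu D \is a fin_num.
  rewrite ge0_fin_numE//; apply: (@le_lt_trans _ _ (mu `[t0, u])).
    apply: le_measure; rewrite ?inE// => t [Lt /=]; rewrite !in_itv /= andbT => t0t.
    by rewrite ltW//= ltW// Lltu.
  by rewrite lebesgue_measure_itv /=; case: ifP; rewrite // -EFinB ltry.
exists t0, (fine (mu D)); split; first by rewrite fineK.
  by move=> j jI kj rj; have [] := early j jI kj rj.
rewrite -lee_fin fineK// -sumEFin.
have -> : mu D = (\int[mu]_(t in D) (cst 1%:E) t)%E by rewrite integral_cst// mul1e.
apply: (@le_trans _ _ (\int[mu]_(t in D) \sum_(j <- jobs I |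
    (key (release I j) <= c)%R && (t0 <= release I j)%R)
    (((x j) \_ `[release I j, C j]) t)%:E)%E).
  apply: ge0_le_integral => //.
  - apply: (eq_measurable_fun (fun t : R => (\sum_(j <- [seq j <- jobs I | (key (release I j) <= c)%R && (t0 <= release I j)%R])
      (if (j \in jobs I) then ((x j) \_ `[release I j, C j]) t else 0)%:E)%E)).
      move=> t _; rewrite big_filter [LHS]big_seq_cond [RHS]big_seq_cond.
      by apply: eq_bigr => n /andP[-> _].
    apply: emeasurable_sum => j; apply/measurable_EFinP.
    case: (boolP (j \in jobs I)) => // jI; apply: measurable_funTS.
    have mi : measurable (`[release I j, C j]%classic : set R) by [].
    by apply/(measurable_restrictT _ mi); apply: measurable_funTS; apply: mx.
  - move=> t [Lt] /=; rewrite in_itv /= andbT => t0t.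
    (* After [t0] no time of [L] is in [S], so a class job is pending. The job [i] then run has no
       larger key, hence is in the class; it was released no earlier than [t0], since class jobs
       released before are complete by then. So the integrand is at least 1. *)
    have [j [jI kj rj pj]] : exists j, [/\ j \in jobs I, key (release I j) <= c,
        release I j < t & pending I x t j].
      apply: contrapT => H.
      have : S t by split=> // j jI kj rj pj; apply: H; exists j.
      by move/(sup_upper_bound hS); rewrite leNgt t0t.
    have [[np _]|[i [pi imin iruns]]] := px t; first by case: (np j).
    have ki : key (release I i) <= c by apply: le_trans kj; apply: imin.
    have [iI rit _] := pi.
    have t0i : t0 <= release I i.
      rewrite leNgt; apply/negP => it0; have [_ Ci] := early i iI ki it0.
      by have := lt_le_trans t0t (le_trans (Ppend _ _ pi) Ci); rewrite ltxx.
    rewrite sumEFin lee_fin big_mkcond (bigD1_seq i)//=; last exact: fset_uniq.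
    rewrite ki t0i/= patchE mem_set/=; last by rewrite in_itv /= rit Ppend.
    rewrite (iruns _ iI) eqxx lerDl big_seq_cond; apply: sumr_ge0 => k /andP[kI _].
    by case: ifP => // _; rewrite patchE; case: ifP => // _; apply: x0.
rewrite ge0_integral_sum_seq//; last 2 first.
- move=> j jI; apply/measurable_EFinP; apply: measurable_funTS.
  have mi : measurable (`[release I j, C j]%classic : set R) by [].
    by apply/(measurable_restrictT _ mi); apply: measurable_funTS; apply: mx.
- by move=> j t jI _; rewrite lee_fin patchE; case: ifP => // _; apply: x0.
rewrite big_seq_cond [leRHS]big_seq_cond; apply: lee_sum => j /andP[jI _].
rewrite (servedE C sx jI)//.
rewrite (_ : (fun t => _) = ((EFin \o x j) \_ `[release I j, C j])); last first.
  by apply/funext => t; rewrite !patchE; case: ifP.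
rewrite -integral_mkcondr; apply: (integral_rate_mono (mx _ jI) (x0 _ ^~ jI)).
- by apply: measurableI.
- by apply: measurableI.
- by move=> t [[]].
Qed.

Definition first_completes I x C := completes I x C /\
  forall j t, j \in jobs I -> release I j <= t ->
     ((proc I j)%:E <= work I x j t)%E -> C j <= t.

(** The infimum is attained by [inf_reach]; once the work is at least [proc I j], [reach] supplies
    an exact completion time that is no later. *)
Lemma completion_first s I y : feasible s I y ->
  first_completes I y (completion I y).
Proof.
move=> [sy ne]; have [my y0 _ _] := sy; split=> [j jI|j t jI rt pw].
  exact: (inf_reach (my _ jI) (y0 _ ^~ jI) (fun t => @rate_le _ _ _ _ t sy jI) (ne _ jI)).
have [c /andP[rc ct] Wc] := reach (my _ jI) (y0 _ ^~ jI) (fun t => @rate_le _ _ _ _ t sy jI)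
  (ltW (proc_gt0 jI)) rt pw.
apply: le_trans ct; apply: ge_inf; last by split.
by exists (release I j) => u [].
Qed.

Section Dominance.
Variables (key : R -> R) (I : instance R) (x : rates R) (C : nat -> R).
Hypothesis sx : schedule 1 I x.
Hypothesis px : prioritizes key I x.
Hypothesis Cx : first_completes I x C.

(** The policy attains the bound of [served_sum_le]: within [L] it finishes the class jobs released
    before [t0] and gives the remaining [l] units of time to the later ones. *)
Lemma served_dominates c y D (L : set R) :
  schedule 1 I y -> completes I y D -> downset L ->
  \sum_(j <- jobs I | key (release I j) <= c) served I y D j L <=
  \sum_(j <- jobs I | key (release I j) <= c) served I x C j L.
Proof.
move=> sy cy dL; have mL := measurable_downset dL; have [cx Cf] := Cx.
have [->|LT] := eqVneq L setT.
  rewrite big_seq_cond [leRHS]big_seq_cond; apply: ler_sum => j /andP[jI _].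
  by rewrite (served_full sy cy jI)// (served_full sx cx jI).
have [t0 [l [El early lx]]] := busy_period c sx px cx Cf dL LT.
apply: le_trans (served_sum_le _ sy cy mL El) _; rewrite mul1r.
rewrite [leRHS](bigID (fun j => release I j < t0))/=; apply: lerD; last first.
  by under [leRHS]eq_bigl do rewrite -leNgt.
rewrite big_seq_cond [leRHS]big_seq_cond; apply: ler_sum => j /and3P[jI kj rj].
rewrite (served_full sx cx jI)// => t; rewrite /= in_itv /= => /andP[_ tC].
exact: dL (early _ jI kj rj) tC.
Qed.

(** The right-hand side is the service under the fictitious schedule. Class jobs released before
    [t0] have both atoms in [L]. For the others the atom at the release is enough: it has mass
    [s * proc I j], and if it lies outside the downset [L], the policy does not serve the job in [L]
    at all. *)
Lemma served_le_atoms s c y D (L : set R) : 0 <= s <= 1 ->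
  schedule s I y -> completes I y D -> downset L ->
  \sum_(j <- jobs I | key (release I j) <= c) served I y D j L <=
  \sum_(j <- jobs I | key (release I j) <= c)
    ((1 - s) * proc I j * (C j \in L)%:R + s * proc I j * (release I j \in L)%:R).
Proof.
move=> /andP[s0 s1] sy cy dL; have mL := measurable_downset dL; have [cx Cf] := Cx.
have p0 j : j \in jobs I -> 0 <= proc I j by move=> jI; apply/ltW/proc_gt0.
have rC j : j \in jobs I -> release I j <= C j by move=> /cx [].
have [->|LT] := eqVneq L setT.
  rewrite big_seq_cond [leRHS]big_seq_cond; apply: ler_sum => j /andP[jI _].
  by rewrite (served_full sy cy jI)// !in_setT !mulr1; lra.
have [t0 [l [El early lx]]] := busy_period c sx px cx Cf dL LT.
apply: le_trans (served_sum_le _ sy cy mL El) _.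
rewrite [leRHS](bigID (fun j => release I j < t0))/=; apply: lerD.
  rewrite big_seq_cond [leRHS]big_seq_cond; apply: ler_sum => j /and3P[jI kj rj].
  have LC := early _ jI kj rj.
  have Lr : L (release I j) by apply: dL LC _; apply: rC.
  by rewrite !mem_set// !mulr1; lra.
under [leRHS]eq_bigl do rewrite -leNgt.
apply: le_trans (ler_wpM2l s0 lx) _; rewrite mulr_sumr.
rewrite big_seq_cond [leRHS]big_seq_cond; apply: ler_sum => j /and3P[jI kj rj].
apply: (@le_trans _ _ (s * proc I j * (release I j \in L)%:R)); last first.
  by rewrite lerDr !mulr_ge0 ?p0// subr_ge0.
have [_|nLr] := boolP (release I j \in L).
  by rewrite mulr1 ler_wpM2l// (served_le sx cx jI).
rewrite mulr0; suff -> : served I x C j L = 0 by rewrite mulr0.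
have -> : served I x C j L = served I x C j set0.
  rewrite /served; congr (fine (integral _ _ _)); rewrite setI0.
  apply/seteqP; split=> // t [/=]; rewrite in_itv /= => /andP[rt _] Lt.
  by move/negP: nLr; apply; rewrite inE; apply: dL rt.
by rewrite /served setI0 integral_set0.
Qed.

End Dominance.

(** A job that never completes stays pending and keeps the machine busy from its release on. Over a
    stretch one unit longer than the total processing time [P] this yields more work than there
    is. *)
Lemma prioritizes_feasible key I x : schedule 1 I x -> prioritizes key I x ->
  feasible 1 I x.
Proof.
move=> sx px; split=> // j jI; have [mx x0 xr xs] := sx.
have xM k : k \in jobs I -> forall t, x k t <= 1 by move=> kI t; exact: (rate_le _ sx kI).
have reached k t : k \in jobs I -> release I k <= t -> ((proc I k)%:E <= work I x k t)%E ->
    exists2 c, release I k <= c & work I x k c = (proc I k)%:E.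
  move=> kI rt pw.
  have [c /andP[rc ct] Wc] := reach (mx _ kI) (x0 _ ^~ kI) (xM _ kI)
    (ltW (proc_gt0 kI)) rt pw.
  by exists c.
apply: contrapT => nC.
have pendj t : release I j <= t -> pending I x t j.
  move=> rt; split=> //; rewrite ltNge; apply/negP => pw; apply: nC.
  by have [c rc Wc] := reached _ _ jI rt pw; exists c.
(* Once the work on [k] reaches [proc I k], the job is no longer pending and the policy gives it
   rate 0. *)
have Wle k t : k \in jobs I -> (work I x k t <= (proc I k)%:E)%E.
  move=> kI; rewrite leNgt; apply/negP => lt.
  have rt : release I k <= t.
    rewrite leNgt; apply/negP => tr; move: lt.
    rewrite /work set_itv_ge ?integral_set0 ?lte_fin ?bnd_simp -?ltNge//.
    by rewrite ltNge ltW// proc_gt0.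
  have [c rc Wc] := reached _ _ kI rt (ltW lt).
  have ct : c <= t.
    rewrite leNgt; apply/negP => tc.
    by have := work_mono sx kI (ltW tc); rewrite Wc leNgt lt.
  move: lt; rewrite /work (@integral_rate_split _ _ (mx _ kI) (x0 _ ^~ kI) _ `[release I k, c])//.
  rewrite setIidr; last by apply: subset_itvl; rewrite bnd_simp.
  rewrite -/(work I x k c) Wc [X in (_ + X)%E]integral0_eq ?adde0 ?ltxx// => u [/=].
  rewrite !in_itv /= => /andP[ru ut] /negP; rewrite ru /= -ltNge => cu.
  have npu : ~ pending I x u k.
    by move=> [_ _]; rewrite ltNge -Wc (work_mono sx kI (ltW cu)).
  have [[_ /(_ k kI) ->//]|[i [pi _ /(_ k kI) ->]]] := px u.
  by case: eqP => // ki; case: npu; rewrite ki.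
pose P := \sum_(k <- jobs I) proc I k.
have P0 : 0 <= P.
  by rewrite /P big_seq; apply: sumr_ge0 => k kI; apply/ltW/proc_gt0.
pose T := release I j + P + 1.
suff : ((P + 1)%:E <= P%:E)%E by rewrite lee_fin; lra.
have -> : (P + 1)%:E = (\int[mu]_(t in `[release I j, T]) (cst 1%:E) t)%E.
  rewrite integral_cst//= mul1e lebesgue_measure_itv /= lte_fin ifT; last by rewrite /T; lra.
  by rewrite -EFinB; congr EFin; rewrite /T; lra.
apply: (@le_trans _ _ (\int[mu]_(t in `[release I j, T]) \sum_(k <- jobs I | true) (x k t)%:E)%E).
  apply: ge0_le_integral => //.
  - apply: (eq_measurable_fun (fun t : R => (\sum_(k <- jobs I)
      (if (k \in jobs I) then x k t else 0)%:E)%E)).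
      by move=> t _; rewrite big_seq [RHS]big_seq; apply: eq_bigr => n ->.
    apply: emeasurable_sum => k; apply/measurable_EFinP.
    by case: (boolP (k \in jobs I)) => // kI; apply: measurable_funTS; apply: mx.
  - move=> t; rewrite /= in_itv /= => /andP[rt _].
    have [[np _]|[i [[iI _ _] _ iruns]]] := px t; first by case: (np j); apply: pendj.
    rewrite sumEFin lee_fin (bigD1_seq i)//=; last exact: fset_uniq.
    rewrite (iruns _ iI) eqxx lerDl big_seq_cond; apply: sumr_ge0 => k /andP[kI _].
    exact: x0.
rewrite ge0_integral_sum_seq//; last 2 first.
- by move=> k kI; apply/measurable_EFinP; apply: measurable_funTS; apply: mx.
- by move=> k t kI _; rewrite lee_fin; apply: x0.
rewrite -sumEFin big_seq [leRHS]big_seq; apply: lee_sum => k kI.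
apply: le_trans (Wle k T kI).
have -> : (\int[mu]_(t in `[release I j, T]) (x k t)%:E =
    \int[mu]_(t in `[release I j, T] `&` `[release I k, +oo[) (x k t)%:E)%E.
  rewrite [RHS]integral_mkcondr; apply: eq_integral => t _; rewrite patchE.
  case: ifPn => //; rewrite notin_setE /= in_itv /= andbT => /negP; rewrite -ltNge => tr.
  by rewrite xr.
apply: (integral_rate_mono (mx _ kI) (x0 _ ^~ kI)) => //; first exact: measurableI.
by move=> t [/=]; rewrite !in_itv /= andbT => /andP[_ ->] ->.
Qed.
End Schedules.

(** * Comparison of the costs *)

Section Costs.
Variable R : realType.
Local Notation mu := (@lebesgue_measure R).
Implicit Types (I : instance R) (x y : rates R) (C : nat -> R) (key : R -> R).

Lemma downset_le (h : R -> R) v : nonneg_nondecr setT h ->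
  downset [set t | h t <= v].
Proof. by move=> [_ hm] t u /= ht ut; apply: le_trans ht; apply: hm. Qed.

Lemma setC_le (h : R -> R) v : [set t | v < h t] = ~` [set t | h t <= v].
Proof. by apply/seteqP; split=> t /=; rewrite ltNge => /negP. Qed.

Lemma integral_layers s I y C (P : pred nat) h :
  schedule s I y -> nonneg_nondecr setT h ->
  measurable_fun (`[0, +oo[%classic : set R)
    (fun v : R => (\sum_(j <- jobs I | P j) served I y C j [set t | (v < h t)%R])%:E) /\
  (\sum_(j <- jobs I | P j)
     \int[mu]_(t in `[release I j, C j]) (h t * y j t)%:E =
   \int[mu]_(v in `[0%R, +oo[)
     (\sum_(j <- jobs I | P j) served I y C j [set t | (v < h t)%R])%:E)%E.
Proof.
move=> sy hh; have [my y0 _ _] := sy.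
have mU v : measurable [set t | v < h t].
  by rewrite setC_le; apply: measurableC; apply: measurable_downset; apply: downset_le.
have mr j : measurable (`[release I j, C j]%classic : set R) by [].
pose F j v := (\int[mu]_(t in `[release I j, C j] `&` [set t | (v < h t)%R]) (y j t)%:E)%E.
have LC j (jI : j \in jobs I) := layer_cake (mr j) (my _ jI) (fun t _ => y0 j t jI) hh.
have E v : (\sum_(j <- jobs I | P j) served I y C j [set t | (v < h t)%R])%:E =
    (\sum_(j <- jobs I | P j) F j v)%E.
  rewrite -sumEFin big_seq_cond [RHS]big_seq_cond; apply: eq_bigr => j /andP[jI _].
  by rewrite (servedE C sy jI).
split.
  apply: (eq_measurable_fun (fun v => (\sum_(j <- [seq j <- jobs I | P j])
     if j \in jobs I then F j v else 0)%E)).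
    move=> v _; rewrite E big_filter [LHS]big_seq_cond [RHS]big_seq_cond.
    by apply: eq_bigr => j /andP[-> _].
  apply: emeasurable_sum => j.
  by case: (boolP (j \in jobs I)) => // jI; have [] := LC _ jI.
transitivity (\int[mu]_(v in `[0%R, +oo[) \sum_(j <- jobs I | P j) F j v)%E; last first.
  by apply: eq_integral => v _; rewrite E.
rewrite ge0_integral_sum_seq//.
- rewrite big_seq_cond [RHS]big_seq_cond; apply: eq_bigr => j /andP[jI _].
  by have [_ ->] := LC _ jI.
- by move=> j jI; have [] := LC _ jI.
- by move=> j v jI _; apply: integral_ge0 => t _; rewrite lee_fin y0.
Qed.

Section ClassCost.
Variables (key : R -> R) (I : instance R) (x : rates R) (C : nat -> R).
Hypothesis sx : schedule 1 I x.
Hypothesis px : prioritizes key I x.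
Hypothesis Cx : first_completes I x C.
Variables (c : R) (h : R -> R).
Hypothesis hh : nonneg_nondecr setT h.

(** By the layer cake, the class cost integrates over [v] the service received outside the downset
    [h t <= v], that is, the total processing time minus the service inside. The policy maximizes
    the latter. *)
Lemma class_cost_le y D : schedule 1 I y -> completes I y D ->
  (\sum_(j <- jobs I | (key (release I j) <= c)%R)
     \int[mu]_(t in `[release I j, C j]) (h t * x j t)%:E <=
   \sum_(j <- jobs I | (key (release I j) <= c)%R)
     \int[mu]_(t in `[release I j, D j]) (h t * y j t)%:E)%E.
Proof.
move=> sy cy; have [cx _] := Cx.
have [mX ->] := integral_layers C (fun j => key (release I j) <= c) sx hh.
have [mY ->] := integral_layers D (fun j => key (release I j) <= c) sy hh.
apply: ge0_le_integral => //.
  move=> v _; rewrite lee_fin big_seq_cond; apply: sumr_ge0 => j /andP[jI _].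
  exact: (served_ge0 _ sx).
move=> v _; rewrite lee_fin setC_le.
have dL := @downset_le h v hh; have mL := measurable_downset dL.
have E z B : schedule 1 I z -> completes I z B ->
    \sum_(j <- jobs I | key (release I j) <= c) served I z B j (~` [set t | h t <= v]) =
    \sum_(j <- jobs I | key (release I j) <= c) proc I j -
    \sum_(j <- jobs I | key (release I j) <= c) served I z B j [set t | h t <= v].
  move=> sz cz; rewrite -sumrB big_seq_cond [RHS]big_seq_cond.
  by apply: eq_bigr => j /andP[jI _]; rewrite (served_setC sz cz jI).
by rewrite !E// lerB// (served_dominates sx px Cx c sy cy dL).
Qed.

(** Same comparison, level by level, with the fictitious schedule in place of the policy;
    [layer_cake_point] integrates its atoms. *)
Lemma class_cost_atoms_le s y D : 0 <= s <= 1 ->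
  schedule s I y -> completes I y D ->
  ((\sum_(j <- jobs I | (key (release I j) <= c)%R)
     ((1 - s) * proc I j * h (C j) + s * proc I j * h (release I j)))%:E <=
   \sum_(j <- jobs I | (key (release I j) <= c)%R)
     \int[mu]_(t in `[release I j, D j]) (h t * y j t)%:E)%E.
Proof.
move=> s01 sy cy; have [s0 s1] := andP s01; have [cx _] := Cx; have [h0 hm] := hh.
have [mY ->] := integral_layers D (fun j => key (release I j) <= c) sy hh.
have p0 j : j \in jobs I -> 0 <= proc I j by move=> jI; apply/ltW/proc_gt0.
have a0 j : j \in jobs I -> 0 <= (1 - s) * proc I j.
  by move=> jI; rewrite mulr_ge0 ?p0// subr_ge0.
have b0 j : j \in jobs I -> 0 <= s * proc I j by move=> jI; rewrite mulr_ge0 ?p0.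
pose A j v := ((1 - s) * proc I j * (v < h (C j))%R%:R)%:E.
pose B j v := (s * proc I j * (v < h (release I j))%R%:R)%:E.
have PA j (jI : j \in jobs I) := layer_cake_point (a0 _ jI) (h0 (C j) Logic.I).
have PB j (jI : j \in jobs I) := layer_cake_point (b0 _ jI) (h0 (release I j) Logic.I).
have mAB j : j \in jobs I ->
    measurable_fun (`[0, +oo[%classic : set R) (fun v => (A j v + B j v)%E).
  by move=> jI; apply: emeasurable_funD; [have [] := PA j jI|have [] := PB j jI].
rewrite (_ : (_%:E) = \int[mu]_(v in `[0%R, +oo[)
    \sum_(j <- jobs I | (key (release I j) <= c)%R) (A j v + B j v))%E; last first.
  rewrite ge0_integral_sum_seq//; last first.
    by move=> j v jI _; rewrite adde_ge0// lee_fin mulr_ge0 ?a0 ?b0.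
  rewrite -sumEFin big_seq_cond [RHS]big_seq_cond; apply: eq_bigr => j /andP[jI _].
  rewrite ge0_integralD//.
  - by have [_ ->] := PA j jI; have [_ ->] := PB j jI; rewrite EFinD.
  - by move=> v _; rewrite lee_fin mulr_ge0 ?a0.
  - by have [] := PA j jI.
  - by move=> v _; rewrite lee_fin mulr_ge0 ?b0.
  - by have [] := PB j jI.
apply: ge0_le_integral => //.
- move=> v _; rewrite big_seq_cond; apply: sume_ge0 => j /andP[jI _].
  by rewrite adde_ge0// lee_fin mulr_ge0 ?a0 ?b0.
- apply: (eq_measurable_fun (fun v => (\sum_(j <- [seq j <- jobs I | (key (release I j) <= c)%R])
     if j \in jobs I then A j v + B j v else 0)%E)).
    move=> v _; rewrite big_filter [LHS]big_seq_cond [RHS]big_seq_cond.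
    by apply: eq_bigr => j /andP[-> _].
  apply: emeasurable_sum => j.
  by case: (boolP (j \in jobs I)) => // jI; apply: mAB.
move=> v _; rewrite setC_le.
have dL := @downset_le h v hh; have mL := measurable_downset dL.
under eq_bigr do rewrite -EFinD.
rewrite sumEFin lee_fin.
have -> : \sum_(j <- jobs I | key (release I j) <= c)
      served I y D j (~` [set t | h t <= v]) =
    \sum_(j <- jobs I | key (release I j) <= c) proc I j -
    \sum_(j <- jobs I | key (release I j) <= c) served I y D j [set t | h t <= v].
  rewrite -sumrB big_seq_cond [RHS]big_seq_cond.
  by apply: eq_bigr => j /andP[jI _]; rewrite (served_setC sy cy jI).
have H := served_le_atoms sx px Cx c s01 sy cy dL.
apply: (le_trans _ (lerB (lexx _) H)); rewrite -sumrB; apply: ler_sum => j _.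
have -> u : (u \in [set t | h t <= v]) = (h u <= v) by apply/idP/idP; rewrite inE.
have -> u : (u \in [set t | h t <= v]) = (h u <= v) by apply/idP/idP; rewrite inE.
(* The two atoms of [j] have total mass [proc I j], so the mass above level [v] is what the downset
   leaves. *)
by rewrite !ltNge; case: (h (C j) <= v); case: (h _ <= v) => /=; lra.
Qed.

End ClassCost.

(** Up to the factor [delta], a common lower bound for the fractional and the integral cost of a
    schedule, which may go on serving completed jobs. *)
Definition truncated_cost (g : R -> R) I y C : \bar R :=
  (\sum_(j <- jobs I)
     \int[mu]_(t in `[release I j, C j]) (g (t - release I j) * y j t)%:E)%E.

Section TruncatedCost.
Variables (g : R -> R).
Hypothesis g_ge0 : forall t : R, 0 <= t -> 0 <= g t.
Hypothesis g_nondecr : forall s t : R, 0 <= s -> s <= t -> g s <= g t.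
Hypothesis g0 : g 0 = 0.

Let mgy (r : R) : measurable_fun (`[r, +oo[%classic : set R) (fun t => g (t - r)).
Proof.
have [e0 em] := extend0_nonneg_nondecr g_ge0 g_nondecr.
apply: (@eq_measurable_fun _ _ _ _ _ (fun t : R => extend0 g (t - r))).
  by move=> t; rewrite inE /= in_itv /= andbT => rt; rewrite /extend0 subr_ge0 rt.
by apply: nondecreasing_measurable => // u t ut; apply: em => //; rewrite lerD2r.
Qed.

Let itv_sub (r C : R) : `[r, C] `<=` `[r, +oo[.
Proof. by move=> t; rewrite /= !in_itv /= andbT => /andP[]. Qed.

Let gmulyE s I y j : schedule s I y -> j \in jobs I ->
  measurable_fun (`[release I j, +oo[%classic : set R)
    (fun t => (g (t - release I j) * y j t)%:E).
Proof.
move=> [my _ _ _] jI; apply/measurable_EFinP/measurable_funM => //.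
by apply: measurable_funTS; apply: my.
Qed.

Let gmulE s I y (e : R) j : schedule s I y -> j \in jobs I ->
  measurable_fun (`[release I j, e]%classic : set R)
    (fun t => (g (t - release I j) * y j t)%:E).
Proof.
by move=> sy jI; apply: (measurable_funS _ (@itv_sub _ _) (gmulyE sy jI)).
Qed.

Let gy_ge0 s I y j t : schedule s I y -> j \in jobs I -> release I j <= t ->
  0 <= g (t - release I j) * y j t.
Proof. by move=> [_ y0 _ _] jI rt; rewrite mulr_ge0 ?y0// g_ge0// subr_ge0. Qed.

Section Layered.
Variables (key : R -> R) (I : instance R).
Variables (n : nat) (c : nat -> R) (h : nat -> R -> R) (kappa : R -> R).
Hypothesis hh : forall i, nonneg_nondecr setT (h i).
Hypothesis kappa_ge0 : forall r, 0 <= kappa r.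
Hypothesis layersE : forall j t, j \in jobs I -> release I j <= t ->
  g (t - release I j) + kappa (release I j) =
  \sum_(i < n | key (release I j) <= c i) h i t.

(** Each job receives exactly [proc I j] up to [C j], so the offset costs
    [kappa (release I j) * proc I j] whatever the schedule. *)
Lemma truncated_cost_layers s y C : schedule s I y -> completes I y C ->
  (truncated_cost g I y C + (\sum_(j <- jobs I) kappa (release I j) * proc I j)%:E =
   \sum_(i < n) \sum_(j <- jobs I | (key (release I j) <= c i)%R)
     \int[mu]_(t in `[release I j, C j]) (h i t * y j t)%:E)%E.
Proof.
move=> sy cy; have [my y0 _ _] := sy.
rewrite (exchange_big_dep xpredT)//= -sumEFin -big_split/=.
rewrite big_seq [RHS]big_seq; apply: eq_bigr => j jI.
have [_ wC] := cy _ jI.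
have myE (D : set R) : measurable_fun D (fun t => (y j t)%:E).
  by apply/measurable_EFinP; apply: measurable_funTS; apply: my.
rewrite EFinM -wC -ge0_integralZl//; last 2 first.
- by move=> t _; rewrite lee_fin y0.
- by rewrite lee_fin.
rewrite -ge0_integralD//; last 4 first.
- by move=> t; rewrite /= in_itv /= => /andP[rt _]; rewrite lee_fin (gy_ge0 sy).
- exact: gmulE sy jI.
- by move=> t _; rewrite -EFinM lee_fin mulr_ge0// y0.
- by apply: measurable_funeM; apply: myE.
transitivity (\int[mu]_(t in `[release I j, C j])
    \sum_(i < n | (key (release I j) <= c i)%R) (h i t * y j t)%:E)%E.
  apply: eq_integral => t; rewrite inE /= in_itv /= => /andP[rt _].
  by rewrite -EFinM -EFinD -mulrDl layersE// sumEFin mulr_suml.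
rewrite -big_filter; set r := (X in _ = \sum_(i <- X) _).
transitivity (\int[mu]_(t in `[release I j, C j]) \sum_(i <- r) (h i t * y j t)%:E)%E.
  by apply: eq_integral => t _; rewrite big_filter.
rewrite ge0_integral_sum//.
- move=> i; apply/measurable_EFinP/measurable_funM; last first.
    by apply: measurable_funTS; apply: my.
  by apply: nondecreasing_measurable => // u t; have [_ hm] := hh i; apply: hm.
- by move=> i t _; rewrite lee_fin mulr_ge0 ?y0//; have [hp _] := hh i; apply: hp.
- exact: myE.
Qed.

(** The atom at the release has age 0 and, as [g 0 = 0], pays only the offset; the offsets of both
    atoms add up to that of a whole job. *)
Lemma atoms_layers s C : (forall j, j \in jobs I -> release I j <= C j) ->
  \sum_(j <- jobs I) (1 - s) * proc I j * g (C j - release I j) +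
  \sum_(j <- jobs I) kappa (release I j) * proc I j =
  \sum_(i < n) \sum_(j <- jobs I | key (release I j) <= c i)
    ((1 - s) * proc I j * h i (C j) + s * proc I j * h i (release I j)).
Proof.
move=> rC; rewrite (exchange_big_dep xpredT)//= -big_split/=.
rewrite big_seq [RHS]big_seq; apply: eq_bigr => j jI.
rewrite big_split/= -!mulr_sumr -!layersE ?rC// subrr g0; lra.
Qed.

End Layered.

Lemma truncated_cost_le_fractional s delta I y C : 0 <= delta ->
  schedule s I y ->
  (delta%:E * truncated_cost g I y C <= fractional_cost g delta I y)%E.
Proof.
move=> d0 sy; rewrite /truncated_cost /fractional_cost big_seq ge0_sume_distrr.
  rewrite [leRHS]big_seq; apply: lee_sum => j jI; apply: lee_wpmul2l => //.
  apply: (@ge0_subset_integral _ _ _ mu _ _ _ _ _ _ _ (@itv_sub _ _)) => //.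
    exact: gmulyE sy jI.
  by move=> t; rewrite /= in_itv /= andbT => rt; rewrite lee_fin (gy_ge0 sy).
move=> j jI; apply: integral_ge0 => t; rewrite /= in_itv /= => /andP[rt _].
by rewrite lee_fin (gy_ge0 sy).
Qed.

Lemma fractional_cost_truncated s delta I y C : 0 <= delta ->
  schedule s I y -> (forall j t, j \in jobs I -> C j < t -> y j t = 0) ->
  (delta%:E * truncated_cost g I y C = fractional_cost g delta I y)%E.
Proof.
move=> d0 sy yC; rewrite /truncated_cost /fractional_cost big_seq ge0_sume_distrr.
  rewrite [RHS]big_seq; apply: eq_bigr => j jI; congr (_ * _)%E.
  rewrite [LHS]integral_mkcond [RHS]integral_mkcond; apply: eq_integral => t _.
  rewrite !patchE.
  have -> : (t \in `[release I j, C j]%classic) = (release I j <= t <= C j).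
    by apply/idP/idP; rewrite inE /= in_itv.
  have -> : (t \in `[release I j, +oo[%classic) = (release I j <= t).
    by apply/idP/idP; rewrite inE /= in_itv /= andbT.
  case: leP => //= rt; case: leP => //= Ct.
  by rewrite (yC _ _ jI Ct) mulr0.
move=> j jI; apply: integral_ge0 => t; rewrite /= in_itv /= => /andP[rt _].
by rewrite lee_fin (gy_ge0 sy).
Qed.

(** Every piece of work on [j] is done at an age of at most [C j - release I j], and
    [delta * proc I j] is the weight. *)
Lemma truncated_cost_le_integral s delta I y C : 0 <= delta ->
  equal_density delta I -> schedule s I y -> completes I y C ->
  (delta%:E * truncated_cost g I y C <=
   (\sum_(j <- jobs I) weight I j * g (C j - release I j))%:E)%E.
Proof.
move=> d0 dI sy cy; rewrite /truncated_cost big_seq ge0_sume_distrr.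
  rewrite -sumEFin [leRHS]big_seq; apply: lee_sum => j jI.
  have [my y0 _ _] := sy; have [rC wC] := cy _ jI.
  have gC0 : 0 <= g (C j - release I j) by apply: g_ge0; rewrite subr_ge0.
  have -> : weight I j * g (C j - release I j) =
      delta * (g (C j - release I j) * proc I j).
    by rewrite -(dI _ jI) mulrCA divfK 1?mulrC// gt_eqF// proc_gt0.
  rewrite EFinM; apply: lee_wpmul2l => //; rewrite EFinM -wC -ge0_integralZl//.
  - apply: ge0_le_integral => //.
    + by move=> t; rewrite /= in_itv /= => /andP[rt _]; rewrite lee_fin (gy_ge0 sy).
    + exact: gmulE sy jI.
    + apply: measurable_funeM; apply/measurable_EFinP.
      by apply: measurable_funTS; apply: my.
    move=> t; rewrite /= in_itv /= => /andP[rt tC].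
    rewrite -EFinM lee_fin ler_wpM2r ?y0// g_nondecr ?subr_ge0//.
    by rewrite lerD2r.
  - by apply/measurable_EFinP; apply: measurable_funTS; apply: my.
  - by move=> t _; rewrite lee_fin y0.
move=> j jI; apply: integral_ge0 => t; rewrite /= in_itv /= => /andP[rt _].
by rewrite lee_fin (gy_ge0 sy).
Qed.

Section Comparison.
Variables (key : R -> R) (I : instance R) (x : rates R) (C : nat -> R).
Hypothesis lkey : layered g key.
Hypothesis sx : schedule 1 I x.
Hypothesis px : prioritizes key I x.
Hypothesis Cx : first_completes I x C.

(** Both schedules pay the same finite offset; adding it to both sides reduces the claim to one
    comparison per class. *)
Lemma truncated_cost_optimal y D : schedule 1 I y -> completes I y D ->
  (truncated_cost g I x C <= truncated_cost g I y D)%E.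
Proof.
move=> sy cy; have [n [c [h [kappa [hh k0 L]]]]] := lkey (map (release I) (jobs I)).
have LE j t (jI : j \in jobs I) : release I j <= t -> g (t - release I j) + kappa (release I j) =
    \sum_(i < n | key (release I j) <= c i) h i t.
  by apply: L; apply: map_f.
have [cx _] := Cx.
rewrite -(@leeD2rE _ (\sum_(j <- jobs I) kappa (release I j) * proc I j)%:E)//.
rewrite (truncated_cost_layers hh k0 LE sx cx) (truncated_cost_layers hh k0 LE sy cy).
by apply: lee_sum => i _; apply: class_cost_le.
Qed.

Lemma truncated_cost_atoms s y D : 0 <= s <= 1 -> schedule s I y -> completes I y D ->
  ((\sum_(j <- jobs I) (1 - s) * proc I j * g (C j - release I j))%:E <=
   truncated_cost g I y D)%E.
Proof.
move=> s01 sy cy; have [n [c [h [kappa [hh k0 L]]]]] := lkey (map (release I) (jobs I)).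
have LE j t (jI : j \in jobs I) : release I j <= t -> g (t - release I j) + kappa (release I j) =
    \sum_(i < n | key (release I j) <= c i) h i t.
  by apply: L; apply: map_f.
have [cx _] := Cx.
rewrite -(@leeD2rE _ (\sum_(j <- jobs I) kappa (release I j) * proc I j)%:E)//.
rewrite (truncated_cost_layers hh k0 LE sy cy) -EFinD.
rewrite (atoms_layers LE); last by move=> j /cx[].
by rewrite -sumEFin; apply: lee_sum => i _; apply: (class_cost_atoms_le sx px).
Qed.

End Comparison.
End TruncatedCost.
End Costs.

(** * Fixed-priority algorithms *)

Section FixedPriority.
Variable R : realType.
Local Notation mu := (@lebesgue_measure R).
Variable key : R -> R.
Implicit Types (I : instance R).

(** The run set of a job when [B] is the time taken by jobs of higher priority: all free time after
    [r] until an amount [p] of it has passed. *)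
Definition slot (r p : R) (B : set R) : set R :=
  [set t | [/\ r <= t, ~ B t & (mu (`[r, t] `\` B) < p%:E)%E]].

Lemma free_time_mono (r : R) (B : set R) u t : measurable B -> u <= t ->
  (mu (`[r, u] `\` B) <= mu (`[r, t] `\` B))%E.
Proof.
move=> mB ut; apply: le_measure; rewrite ?inE; try exact: measurableD.
by apply: setSD; apply: subset_itvl; rewrite bnd_simp.
Qed.

Lemma measurable_slot (r p : R) (B : set R) : measurable B -> measurable (slot r p B).
Proof.
move=> mB; rewrite (_ : slot r p B = `[r, +oo[ `&` ~` B `&`
    [set t | (mu (`[r, t] `\` B) < p%:E)%E]).
  apply: measurableI; last first.
    apply: measurable_downset => t u /= lt ut.
    by apply: le_lt_trans lt; apply: free_time_mono.
  by apply: measurableI => //; exact: measurableC.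
apply/seteqP; split=> t /=; first by move=> [rt nB lt]; rewrite in_itv /= rt.
by rewrite in_itv /= andbT => -[[]].
Qed.

(** The slot is contained in the free time and exhausts it as long as less than [p] of it has
    passed. Hence [B] alone tells whether the job is pending. *)
Lemma slot_work (r p : R) (B : set R) (t : R) : measurable B -> 0 < p ->
  ((\int[mu]_(u in `[r, t]) (\1_(slot r p B) u)%:E < p%:E)%E =
   (mu (`[r, t] `\` B) < p%:E)%E).
Proof.
move=> mB p0; have mS := measurable_slot r p mB.
rewrite integral_indic//=; apply/idP/idP; last first.
  apply: le_lt_trans; apply: le_measure; rewrite ?inE; [exact: measurableI|exact: measurableD|].
  by move=> u [[ru nBu _] ut].
apply: contraLR; rewrite -!leNgt => le.
have [rt|tr] := leP r t; last first.
  rewrite set_itv_ge ?bnd_simp -?ltNge// set0D measure0 lee_fin in le.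
  by have := lt_le_trans p0 le; rewrite ltxx.
rewrite leNgt; apply/negP => lt.
have fin : mu (slot r p B `&` `[r, t]) \is a fin_num.
  by rewrite ge0_fin_numE// (lt_trans lt)// ltry.
pose w := fine (mu (slot r p B `&` `[r, t])).
have wE : mu (slot r p B `&` `[r, t]) = w%:E by rewrite fineK.
have w0 : 0 <= w by rewrite fine_ge0.
move: lt; rewrite wE lte_fin => wp.
pose f : R -> R := \1_(~` B).
have fE c : (\int[mu]_(u in `[r, c]) (f u)%:E = mu (`[r, c] `\` B))%E.
  rewrite integral_indic//=; last exact: measurableC.
  by rewrite setIC setDE.
have mf : measurable_fun setT f by apply: measurable_indic; exact: measurableC.
have f0 u : 0 <= f u by [].
have f1 u : f u <= 1 by rewrite /f indicE lern1 leq_b1.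
(* The midpoint lies strictly between [w] and [p]. Up to the time [c] when the free time equals it,
   all free time is in the slot, whose measure would then exceed [w]. *)
have q0 : 0 <= (w + p) / 2 by lra.
have qt : (((w + p) / 2)%:E <= \int[mu]_(u in `[r, t]) (f u)%:E)%E.
  by rewrite fE; apply: le_trans le; rewrite lee_fin; lra.
have [c /andP[rc ct] Wc] := reach mf f0 f1 q0 rt qt.
rewrite fE in Wc.
have : (mu (`[r, c] `\` B) <= w%:E)%E.
  rewrite -wE; apply: le_measure; rewrite ?inE; [exact: measurableD|exact: measurableI|].
  move=> u [/=]; rewrite !in_itv /= => /andP[ru uc] nB; split; last by rewrite ru (le_trans uc).
  split=> //; apply: (le_lt_trans (free_time_mono r mB uc)).
  by rewrite Wc lte_fin; lra.
by rewrite Wc lee_fin; lra.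
Qed.

(** Breaking ties by label gives a strict total order, which singles out the job to run. *)
Definition outranks I k j :=
  (key (release I k) < key (release I j)) ||
  (key (release I k) == key (release I j)) && (k < j)%N.

Lemma outranks_irr I j : outranks I j j = false.
Proof. by rewrite /outranks ltxx ltnn andbF. Qed.

Lemma outranks_trans I : transitive (outranks I).
Proof.
move=> k l j; rewrite /outranks => /orP[lk|/andP[/eqP lk lk']] /orP[kj|/andP[/eqP kj kj']].
- by rewrite (lt_trans lk kj).
- by rewrite -kj lk.
- by rewrite lk kj.
- by rewrite lk kj eqxx (ltn_trans lk' kj') orbT.
Qed.

Lemma outranks_total I k j : k != j -> outranks I k j || outranks I j k.
Proof. by rewrite /outranks neq_ltn; case: ltgtP => //= _; case: ltngtP. Qed.

Definition rank I j := size [seq k <- jobs I | outranks I k j].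

Lemma rank_lt I k j : k \in jobs I -> outranks I k j -> (rank I k < rank I j)%N.
Proof.
move=> kI kj.
apply: (@uniq_leq_size _ (k :: [seq l <- jobs I | outranks I l k])).
  by rewrite /= mem_filter outranks_irr/= filter_uniq// fset_uniq.
move=> l; rewrite inE !mem_filter => /orP[/eqP->|/andP[lk ->]]; first by rewrite kj.
by rewrite (outranks_trans lk kj).
Qed.

(* [n] is fuel: the run set of a job depends on those of the jobs outranking it. *)
Fixpoint run I n j : set R := if n is n'.+1 then
  slot (release I j) (proc I j)
    (\bigcup_(k in [set k | k \in jobs I /\ outranks I k j]) run I n' k)
  else set0.

(** The recursion descends through strictly decreasing ranks, so fuel above the rank never runs
    out. *)
Lemma run_stable I n m j : (rank I j < n)%N -> (rank I j < m)%N ->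
  run I n j = run I m j.
Proof.
elim: n m j => [//|n IH] [//|m] j jn jm /=; congr slot.
apply: eq_bigcupr => k [kI kj]; have kj' := rank_lt kI kj.
by apply: IH; apply: (leq_trans kj').
Qed.

Definition run_set I j := run I (rank I j).+1 j.
Definition blocked I j := \bigcup_(k in [set k | k \in jobs I /\ outranks I k j]) run_set I k.

Lemma run_setE I j : run_set I j = slot (release I j) (proc I j) (blocked I j).
Proof.
rewrite /run_set /=; congr slot; apply: eq_bigcupr => k [kI kj].
by apply: run_stable => //; apply: rank_lt.
Qed.

Lemma measurable_run I n j : measurable (run I n j).
Proof.
elim: n j => [j|n IH j] /=; first exact: measurable0.
by apply: measurable_slot; apply: bigcup_measurable.
Qed.

Lemma measurable_blocked I j : measurable (blocked I j).
Proof. by apply: bigcup_measurable => k _; apply: measurable_run. Qed.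

Definition fixed_priority : algorithm R := fun I j t => \1_(run_set I j) t.

Lemma fixed_priority_pending I t j : pending I (fixed_priority I) t j <->
  [/\ j \in jobs I, release I j <= t &
      (mu (`[release I j, t] `\` blocked I j) < (proc I j)%:E)%E].
Proof.
have E : j \in jobs I -> (work I (fixed_priority I) j t < (proc I j)%:E)%E =
    (mu (`[release I j, t] `\` blocked I j) < (proc I j)%:E)%E.
  move=> jI; rewrite /work /fixed_priority run_setE.
  by rewrite slot_work ?proc_gt0//; exact: measurable_blocked.
by split=> -[jI rt]; rewrite ?E// => lt; split; rewrite ?E.
Qed.

Lemma run_set_pending I t j : j \in jobs I -> run_set I j t ->
  pending I (fixed_priority I) t j.
Proof. by move=> jI; rewrite run_setE => -[rt _ lt]; apply/fixed_priority_pending. Qed.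

(** The pending job of least rank runs: a job blocking it would itself be pending and of smaller
    rank. In turn it blocks all jobs it outranks. *)
Lemma fixed_priority_prioritizes I : prioritizes key I (fixed_priority I).
Proof.
move=> t; set P := pending I (fixed_priority I) t.
have [[j Pj]|nP] := pselect (exists j, P j); last first.
  left; split=> [j Pj|k kI]; first by apply: nP; exists j.
  rewrite /fixed_priority indicE memNset// => /(run_set_pending kI) Pk.
  by apply: nP; exists k.
right; have exn : exists n, `[< exists2 j, P j & rank I j = n >].
  by exists (rank I j); apply/asboolP; exists j.
case: (ex_minnP exn) => _ /asboolP[{Pj}j Pj <-] jmin.
have Pmin k : P k -> ~~ outranks I k j.
  move=> Pk; apply/negP => kj; have [kI _ _] := Pk.
  have := rank_lt kI kj; rewrite ltnNge jmin//.
  by apply/asboolP; exists k.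
have runj : run_set I j t.
  rewrite run_setE; have /fixed_priority_pending[jI rt lt] := Pj.
  split=> // -[k [kI kj]] /(run_set_pending kI) /Pmin.
  by rewrite kj.
have [jI _ _] := Pj.
exists j; split=> // [k /Pmin|k kI].
  by rewrite leNgt; apply: contra => kj; rewrite /outranks kj.
rewrite /fixed_priority indicE; have [->|kj] := eqVneq k j; first by rewrite mem_set.
rewrite memNset// => rk; have /orP[] := outranks_total I kj.
  by apply/negP/Pmin/(run_set_pending kI).
move=> jk; move: rk; rewrite run_setE => -[_ + _]; apply.
by exists j.
Qed.

Lemma fixed_priority_schedule I : schedule 1 I (fixed_priority I).
Proof.
split=> [j _|j t _|j t jI tr|t].
- by apply: measurable_indic; apply: measurable_run.
- by rewrite /fixed_priority.
- rewrite /fixed_priority indicE memNset//; rewrite run_setE => -[rt _ _].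
  by move: rt; rewrite leNgt tr.
have [[_ id]|[j [[jI _ _] _ rj]]] := fixed_priority_prioritizes I t.
  by rewrite big_seq big1.
rewrite (bigD1_seq j)//=; last exact: fset_uniq.
rewrite rj// eqxx big_seq_cond big1 ?addr0// => k /andP[kI kj].
by rewrite rj// (negPf kj).
Qed.

Lemma same_until_sym (t : R) I I' : same_until t I I' -> same_until t I' I.
Proof.
move=> [E D]; split=> // j jk; rewrite -E in jk; by have [-> -> ->] := D _ jk.
Qed.

Lemma known_jobsP I t j :
  reflect (j \in jobs I /\ release I j <= t) (j \in known_jobs I t).
Proof. by rewrite !inE; apply: andP. Qed.

Lemma run_release I n j t : run I n j t -> release I j <= t.
Proof. by case: n => //= n []. Qed.

(** Whether [j] runs at [u] depends on the run sets of the jobs outranking it at times up to [u]. A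
    job running by then has been released, hence is known in both instances. *)
Lemma run_online t n I I' j u : same_until t I I' -> j \in known_jobs I t ->
  u <= t -> run I n j u -> run I' n j u.
Proof.
elim: n I I' j u => [//|n IH] I I' j u II' jk ut.
(* Stated for arbitrary instances, as the blocked sets must be compared in both directions. *)
have sub J J' v : same_until t J J' -> j \in known_jobs J t -> v <= t ->
    (\bigcup_(k in [set k | k \in jobs J /\ outranks J k j]) run J n k) v ->
    (\bigcup_(k in [set k | k \in jobs J' /\ outranks J' k j]) run J' n k) v.
  move=> JJ' jJ vt [k [kJ kj] rk]; have [EJ DJ] := JJ'.
  have kK : k \in known_jobs J t.
    by apply/known_jobsP; split=> //; apply: le_trans (run_release rk) vt.
  have kK' := kK; rewrite EJ in kK'; have /known_jobsP[kJ' _] := kK'.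
  exists k; last exact: (IH J).
  split=> //; move: kj; rewrite /outranks.
  by have [-> _ _] := DJ _ kK; have [-> _ _] := DJ _ jJ.
have [E D] := II'; have jk' := jk; rewrite E in jk'.
have [Er Ep _] := D _ jk.
have sym := same_until_sym II'.
move=> /= [rj nB lt]; split; first by rewrite -Er.
  by move=> B'; apply: nB; apply: (sub _ _ _ sym).
rewrite -Er -Ep; move: lt; congr (_ < _)%E; congr (mu _).
apply/seteqP; split=> v [/=]; rewrite in_itv /= => /andP[rv vu] nv; split=> //.
- by rewrite rv vu.
- by move=> B'; apply: nv; apply: (sub _ _ _ sym) => //; apply: le_trans ut.
- by rewrite rv vu.
- by move=> B'; apply: nv; apply: (sub _ _ _ II') => //; apply: le_trans ut.
Qed.

Lemma fixed_priority_online : online_algorithm fixed_priority.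
Proof.
split=> [I|I I' t II' j u jk ut]; first exact: fixed_priority_schedule.
rewrite /fixed_priority !indicE; congr (nat_of_bool _)%:R.
(* The rank of [j] may differ in the two instances, because of outranking jobs released after [t]; a
   common fuel above both ranks makes the run sets comparable. *)
pose n := maxn (rank I j).+1 (rank I' j).+1.
have E : run_set I j = run I n j by apply: run_stable; rewrite // leq_maxl.
have E' : run_set I' j = run I' n j by apply: run_stable; rewrite // leq_maxr.
rewrite E E'; apply/idP/idP; rewrite !inE; apply: (@run_online t) => //.
  exact: same_until_sym.
by have [<-] := II'.
Qed.

End FixedPriority.

(** * Optimality and competitiveness of a priority policy *)

Section Policy.
Variable R : realType.
Variables (g : R -> R) (delta : R).
Hypothesis g_ge0 : forall t : R, 0 <= t -> 0 <= g t.
Hypothesis g_nondecr : forall s t : R, 0 <= s -> s <= t -> g s <= g t.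
Hypothesis g0 : g 0 = 0.
Variables (key : R -> R) (A : algorithm R).
Hypothesis lkey : layered g key.
Hypothesis schedA : forall I, schedule 1 I (A I).
Hypothesis prioA : forall I, prioritizes key I (A I).

(** A negative [delta] forces the instance to be empty, and 0 then serves as density. *)
Lemma density_ge0 I : equal_density delta I -> exists d, [/\ 0 <= d,
  equal_density d I & forall y, fractional_cost g delta I y = fractional_cost g d I y].
Proof.
move=> dI; have [d0|dn] := leP 0 delta; first by exists delta.
have nI j : j \notin jobs I.
  apply/negP => jI; move: dn; rewrite ltNge => /negP; apply.
  by rewrite -(dI _ jI) divr_ge0// ltW ?weight_gt0 ?proc_gt0.
exists 0; split=> // [j jI|y]; first by move: (nI j); rewrite jI.
rewrite /fractional_cost big_seq [RHS]big_seq; apply: eq_bigr => j jI.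
by move: (nI j); rewrite jI.
Qed.

Lemma policy_optimal : fractional_optimal g delta A /\
  forall eps : R, 0 < eps ->
    integral_competitive g delta (1 + eps) ((1 + eps) / eps) A.
Proof.
have feasA I : feasible 1 I (A I) by apply: prioritizes_feasible (prioA I).
split=> [I|eps e0 I] dI; split=> //; have [d [d0 dI' dE]] := density_ge0 dI;
  have Cx := completion_first (feasA I).
- move=> y [sy ney]; rewrite !dE.
  have [cy _] := completion_first (conj sy ney).
  apply: le_trans (truncated_cost_le_fractional g_ge0 g_nondecr _ d0 sy).
  (* The policy never serves a completed job, so truncation leaves its cost unchanged. *)
  rewrite -(fractional_cost_truncated g_ge0 d0 (schedA I) (C := completion I (A I))).
    apply: lee_wpmul2l => //.
    exact: (truncated_cost_optimal g_ge0 g_nondecr lkey (schedA I) (prioA I) Cx sy cy).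
  move=> j t jI Ct; have [cx _] := Cx; have [_ WC] := cx _ jI.
  have np : ~ pending I (A I) t j.
    by move=> [_ _]; rewrite ltNge -WC (work_mono (schedA I) jI (ltW Ct)).
  have [[_ /(_ j jI) ->//]|[i [pi _ /(_ j jI) ->]]] := prioA I t.
  by case: eqP => // ji; case: np; rewrite ji.
(* The offline speed. Here [1 - s = eps / (1 + eps)] is the inverse of the competitive ratio, so the
   bound by atoms is exactly the claim. *)
set s := 1 / (1 + eps).
have s01 : 0 <= s <= 1.
  by rewrite /s divr_ge0//= ?ler_pdivrMr; lra.
set beta := (1 + eps) / eps.
have b0 : 0 < beta by rewrite divr_gt0//; lra.
have bs : beta * (1 - s) = 1.
  by rewrite /beta /s; field; rewrite !gt_eqF//; lra.
have -> : integral_cost g I (A I) = beta * ((1 - s) * integral_cost g I (A I)).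
  by rewrite mulrA bs mul1r.
rewrite EFinM; apply: lee_wpmul2l; first by rewrite lee_fin ltW.
apply: le_ereal_inf_tmp => _ [y [sy ney] <-].
have [cy _] := completion_first (conj sy ney).
apply: le_trans (truncated_cost_le_integral g_ge0 g_nondecr d0 dI' sy cy).
have := truncated_cost_atoms g_ge0 g_nondecr g0 lkey (schedA I) (prioA I) Cx s01 sy cy.
move/(@lee_wpmul2l _ d%:E _ _ _); rewrite lee_fin => /(_ d0); apply: le_trans.
rewrite -EFinM lee_fin /integral_cost !mulr_sumr big_seq [leRHS]big_seq.
apply: ler_sum => j jI.
rewrite -(dI' _ jI) le_eqVlt; apply/orP; left; apply/eqP.
have pj : proc I j != 0 by rewrite gt_eqF// proc_gt0.
by field.
Qed.

End Policy.

Theorem theorem11 (R : realType) (g : R -> R) (delta : R)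
  (g_ge0 : forall t : R, 0 <= t -> 0 <= g t)
  (g_nondecreasing : forall s t : R, 0 <= s -> s <= t -> g s <= g t)
  (g0 : g 0 = 0) :
  (convex_function (`[0, +oo[%classic : set R^o) g ->
     (exists A : algorithm R, online_algorithm A /\ fifo A) /\
     (forall A : algorithm R, online_algorithm A -> fifo A ->
        fractional_optimal g delta A /\
        forall eps : R, 0 < eps ->
          integral_competitive g delta (1 + eps) ((1 + eps) / eps) A)) /\
  (convex_function (`[0, +oo[%classic : set R^o) (fun t => - g t) ->
     (exists A : algorithm R, online_algorithm A /\ lifo A) /\
     (forall A : algorithm R, online_algorithm A -> lifo A ->
        fractional_optimal g delta A /\
        forall eps : R, 0 < eps ->
          integral_competitive g delta (1 + eps) ((1 + eps) / eps) A)).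
Proof.
(* [fifo] is [prioritizes idfun] up to conversion, whereas [lifo] compares release times in the
   reverse order. *)
have lifoP A : lifo A <-> forall I, @prioritizes R -%R I (A I).
  split=> H I t; have [|[j [pj jm rj]]] := H I t; first by left.
  - by right; exists j; split=> // k /jm; rewrite lerN2.
  - by left.
  - by right; exists j; split=> // k /jm; rewrite lerN2.
split=> gc.
  split; first by exists (fixed_priority idfun); split; [exact: fixed_priority_online|exact: fixed_priority_prioritizes].
  move=> A [schA _] fA.
  exact: (policy_optimal _ g_ge0 g_nondecreasing g0 (layered_convex g_ge0 g_nondecreasing g0 gc)).
split.
  exists (fixed_priority -%R); split; first exact: fixed_priority_online.
  by apply/lifoP; exact: fixed_priority_prioritizes.
move=> A [schA _] /lifoP fA.
exact: (policy_optimal _ g_ge0 g_nondecreasing g0 (layered_concave g_ge0 g_nondecreasing g0 gc)).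
Qed.
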